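(* Let $\mu$ be an infinite, translation invariant and semi scale invariant measure on $(\mathfrak{G},\mathcal{F})$, where $\mathfrak{G}$ is the collection of subsets of $\mathbb{R}^d$ of diameter strictly smaller than $1$. Assume that $\mu$ is supported on open sets, and that: (1) for every bounded $A\subset\mathbb{R}^d$ and every $\delta>0$, $\mu(\{G\in\mathfrak{G}: G\cap A\neq\emptyset,\ \mathrm{diam}(G)\geq\delta\})<\infty$; (2) $\mu(\{G\in\mathfrak{G}:\mathcal{L}(\partial G)>0\})=0$; (3) $\mu(\{G\in\mathfrak{G}:\mathcal{L}(G)>0\})>0$. Let $\tilde\mu$ be the measure induced from $\mu$ by taking the closure of these sets (the image of $\mu$ under $G\mapsto\overline{G}$). Then the critical values for $\mu$ and $\tilde\mu$ are the same: $\lambda_e(\mu)=\lambda_e(\tilde\mu)$.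
   Context: $\mathcal{L}$ is Lebesgue measure on $\mathbb{R}^d$, $\partial G$ is the topological boundary of $G$. $\mathfrak{G}=\{G\subset\mathbb{R}^d:\mathrm{diam}(G)<1\}$ is equipped with a suitable $\sigma$-algebra $\mathcal{F}$ (one for which all the subsets of $\mathfrak{G}$, maps and events considered are measurable). Translation invariance of $\mu$: $\mu(x+\mathcal{D})=\mu(\mathcal{D})$ for all $\mathcal{D}\in\mathcal{F}$, $x\in\mathbb{R}^d$, where $x+\mathcal{D}=\{L\subset\mathbb{R}^d: L=x+G\text{ for some }G\in\mathcal{D}\}$. Semi scale invariance of $\mu$: whenever $\mathcal{D}\in\mathcal{F}$ has $\mu(\mathcal{D})<\infty$ and $0<s<\infty$ is such that $\mathcal{D}_s:=\{G\subset\mathbb{R}^d: G/s\in\mathcal{D}\}$ contains only sets of diameter strictly smaller than $1$, then $\mu(\mathcal{D}_s)=\mu(\mathcal{D})$. For an infinite, translation invariant and semi scale invariant measure $\mu$ on $(\mathfrak{G},\mathcal{F})$ and $0<\lambda<\infty$, $\Phi_\lambda(\mu)$ is a Poisson process on $\mathfrak{G}$ with intensity measure $\lambda\mu$, $\mathcal{C}(\Phi_\lambda(\mu))=\mathbb{R}^d\setminus\bigcup_{G\in\Phi_\lambda(\mu)}G$, and $\lambda_e(\mu)=\inf\{\lambda>0:\mathbb{P}(\mathcal{C}(\Phi_\lambda(\mu))=\emptyset)=1\}$. *)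

(* Defs.v *)
From HB Require Import structures.
From mathcomp Require Import all_boot all_order all_algebra.
From mathcomp Require Import all_classical all_reals all_analysis.
From mathcomp Require Import measurable_realfun.
Set Implicit Arguments.
Unset Strict Implicit.
Unset Printing Implicit Defensive.
Import Order.TTheory GRing.Theory Num.Theory.
Import numFieldNormedType.Exports.
Local Open Scope classical_set_scope.
Local Open Scope ring_scope.

Section euclidean_space.
Context (R : realType) (d : nat).
Implicit Types (x y : 'rV[R]_d) (A G : set 'rV[R]_d).

(* The library's norm on ['rV[R]_d] is the sup norm. It gives the usual
   topology and the usual bounded sets, but diameters must be Euclidean. *)
Definition edist x y : R := Num.sqrt (\sum_(i < d) (x 0 i - y 0 i) ^+ 2).

(* Taking the maximum with 0 makes the diameter of the empty set 0. *)
Definition diam A : \bar R :=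
  Order.max 0%E (ereal_sup [set (edist p.1 p.2)%:E | p in A `*` A]).

Definition boundary A : set 'rV[R]_d := closure A `\` interior A.

Definition open_box (ab : 'rV[R]_d * 'rV[R]_d) : set 'rV[R]_d :=
  [set x | forall i, ab.1 0 i < x 0 i < ab.2 0 i].

Definition box_volume (ab : 'rV[R]_d * 'rV[R]_d) : R :=
  \prod_(i < d) (ab.2 0 i - ab.1 0 i).

(* Lebesgue outer measure; on measurable sets, in particular on open sets and
   on boundaries, it is Lebesgue measure. *)
Definition lebesgue A : \bar R :=
  ereal_inf [set (\sum_(0 <= k <oo) (box_volume (ab k))%:E)%E
    | ab in [set ab : nat -> 'rV[R]_d * 'rV[R]_d |
        (forall k i, (ab k).1 0 i <= (ab k).2 0 i) /\
        A `<=` \bigcup_k open_box (ab k)]].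

Lemma edistC x y : edist x y = edist y x.
Proof.
by congr Num.sqrt; apply: eq_bigr => i _; rewrite -sqrrN opprB.
Qed.

Lemma edist_continuous x : continuous (edist x).
Proof.
move=> y; rewrite /edist.
apply: (@continuous_comp _ _ _
  (fun y => \sum_(i < d) (x 0 i - y 0 i) ^+ 2) (@Num.sqrt R)); last first.
  exact: sqrt_continuous.
apply: (@continuous_big _ _ +%R 0 xpredT) => [z|i _ z].
  exact: add_continuous.
have h : {for z, continuous (fun y : 'rV[R]_d => x 0 i - y 0 i)}.
  by apply: continuousB; [exact: cst_continuous|exact: coord_continuous].
by apply: (cvgM h h).
Qed.

Lemma edist_closure A x (r : R) :
  A `<=` [set y | edist x y <= r] -> closure A `<=` [set y | edist x y <= r].
Proof.
move=> Ar; have cl : closed [set y | edist x y <= r].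
  apply: (@preimage_closed _ _ (edist x) [set z | z <= r]); last exact: closed_le.
  by move=> y _; exact: edist_continuous.
rewrite [X in _ `<=` X]((closure_id _).1 cl); exact: closureS.
Qed.

Lemma diam_set0 : diam set0 = 0%E.
Proof. by rewrite /diam set0X image_set0 ereal_sup0 max_l// leNye. Qed.

Lemma diam_closure A : (diam (closure A) <= diam A)%E.
Proof.
have A0 : (0 <= diam A)%E by rewrite /diam le_max lexx.
rewrite [X in (X <= _)%E]/diam ge_max A0/=.
apply: ge_ereal_sup => _ [[x y] [/= cAx cAy] <-].
have [->|Afin] := eqVneq (diam A) +oo%E; first by rewrite leey.
have /fineK Ar : diam A \is a fin_num by rewrite ge0_fin_numE// ltey.
rewrite -Ar lee_fin.
apply: (edist_closure _ cAy) => v Av /=; rewrite edistC.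
apply: (edist_closure _ cAx) => u Au /=.
rewrite -lee_fin Ar le_max; apply/orP; right.
by apply: ereal_sup_ubound; exists (v, u).
Qed.

End euclidean_space.

Record small_set (R : realType) (d : nat) := SmallSet {
  small_val :> set 'rV[R]_d ;
  small_diam : (diam small_val < 1)%E }.

Section small_set_instances.
Context (R : realType) (d : nat).

Lemma small_set0_subproof : (diam (@set0 'rV[R]_d) < 1)%E.
Proof. by rewrite diam_set0 lte_fin ltr01. Qed.

HB.instance Definition _ := gen_eqMixin (small_set R d).
HB.instance Definition _ := gen_choiceMixin (small_set R d).
HB.instance Definition _ :=
  isPointed.Build (small_set R d) (SmallSet small_set0_subproof).

Lemma small_closure_subproof (G : small_set R d) :
  (diam (closure (small_val G)) < 1)%E.
Proof. exact: le_lt_trans (diam_closure _) (small_diam G). Qed.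

Definition small_closure (G : small_set R d) : small_set R d :=
  SmallSet (small_closure_subproof G).

End small_set_instances.

Section families.
Context (R : realType) (d : nat).
Implicit Types (A K : set 'rV[R]_d) (D : set (small_set R d)).

Definition hitting A (delta : R) : set (small_set R d) :=
  [set G | G `&` A !=set0 /\ (delta%:E <= diam G)%E].

Definition containing K : set (small_set R d) := [set G | K `<=` G].

Definition open_sets : set (small_set R d) := [set G | open (small_val G)].

Definition fat_boundary : set (small_set R d) :=
  [set G | (0 < lebesgue (boundary G))%E].

Definition positive_volume : set (small_set R d) :=
  [set G | (0 < lebesgue G)%E].

Definition translate (x : 'rV[R]_d) D : set (small_set R d) :=
  [set L | exists2 G, D G & small_val L = [set x + y | y in small_val G]].

(* $\mathcal D_s$ as a collection of arbitrary subsets of $\mathbb R^d$, so that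
   requiring all of its members to have diameter less than 1 is meaningful *)
Definition rescale (s : R) D : set (set 'rV[R]_d) :=
  [set G | exists2 H, D H & small_val H = [set s^-1 *: y | y in G]].

Definition rescalable (s : R) D :=
  0 < s /\ forall G, rescale s D G -> (diam G < 1)%E.

Definition small_rescale (s : R) D : set (small_set R d) :=
  [set G | rescale s D (small_val G)].

End families.

(* "F is a suitable sigma-algebra": everything considered is measurable. The
   sets [containing K], with [K] compact, are those by which one expresses that
   a region is covered by members of the process. *)
Record suitable (R : realType) (d : nat) (F : set (set (small_set R d)))
    : Prop := Suitable {
  suitable_sigma_algebra : sigma_algebra setT F ;
  suitable_hitting : forall A delta,
    bounded_set A -> 0 < delta -> F (hitting A delta) ;
  suitable_containing : forall K, compact K -> F (containing K) ;
  suitable_open : F (@open_sets R d) ;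
  suitable_boundary : F (@fat_boundary R d) ;
  suitable_volume : F (@positive_volume R d) ;
  suitable_translate : forall x D, F D -> F (translate x D) ;
  suitable_rescale : forall s D,
    F D -> rescalable s D -> F (small_rescale s D) ;
  suitable_closure : forall D, F D -> F (@small_closure R d @^-1` D) }.

Section invariance.
Context (R : realType) (d : nat) (F : set (set (small_set R d))).
Implicit Types mu : set (g_sigma_algebraType F) -> \bar R.

Definition translation_invariant mu :=
  forall x (D : set (g_sigma_algebraType F)),
    measurable D -> mu (translate x D) = mu D.

Definition semi_scale_invariant mu :=
  forall s (D : set (g_sigma_algebraType F)),
    measurable D -> (mu D < +oo)%E -> rescalable s D ->
    mu (small_rescale s D) = mu D.

Definition closure_image mu : set (g_sigma_algebraType F) -> \bar R :=
  pushforward mu (@small_closure R d :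
    g_sigma_algebraType F -> g_sigma_algebraType F).

End invariance.

Section point_process.
Context (R : realType) (disp disp' : measure_display).
Context (T : measurableType disp) (Omega : measurableType disp').

(* A point process is given by an enumeration [pt] of its points: these are the
   [G] with [pt n w = Some G], counted with multiplicity. *)
Definition point_in (pt : nat -> Omega -> option T) n (D : set T) : set Omega :=
  [set w | exists2 G, pt n w = Some G & D G].

Definition point_count (pt : nat -> Omega -> option T) (D : set T) (w : Omega)
    : \bar R :=
  (\sum_(0 <= n <oo) (\1_(point_in pt n D) w)%:E)%E.

(* The intensity of a set may be 0 or [+oo]. *)
Record is_poisson (P : probability Omega R) (pt : nat -> Omega -> option T)
    (nu : set T -> \bar R) : Prop := IsPoisson {
  poisson_measurable : forall n D,
    measurable D -> measurable (point_in pt n D) ;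
  poisson_fin : forall D (r : R) k, measurable D -> nu D = r%:E ->
    P [set w | point_count pt D w = k%:R%:E] =
      (r ^+ k / k`!%:R * expR (- r))%:E ;
  poisson_oo : forall D, measurable D -> nu D = +oo%E ->
    P [set w | point_count pt D w = +oo%E] = 1%E ;
  poisson_independent :
    forall m (D : 'I_m -> set T) (B : 'I_m -> set (\bar R)),
    (forall i, measurable (D i)) -> trivIset setT D ->
    (forall i, measurable (B i)) ->
    P [set w | forall i, B i (point_count pt (D i) w)] =
      (\prod_(i < m) P [set w | B i (point_count pt (D i) w)])%E }.

End point_process.

Record poisson_process (R : realType) (disp : measure_display)
    (T : measurableType disp) (nu : set T -> \bar R) := PoissonProcess {
  pp_disp : measure_display ;
  pp_space : measurableType pp_disp ;
  pp_prob : probability pp_space R ;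
  pp_point : nat -> pp_space -> option T ;
  pp_is_poisson : is_poisson pp_prob pp_point nu }.

Section critical_value.
Context (R : realType) (d : nat) (F : set (set (small_set R d))).
Implicit Types nu : set (g_sigma_algebraType F) -> \bar R.

Definition vacant nu (Phi : poisson_process nu) (w : pp_space Phi)
    : set 'rV[R]_d :=
  ~` [set x | exists n (G : small_set R d), pp_point n w = Some G /\ small_val G x].

(* a choice of $\Phi_\lambda(\nu)$ for every $\lambda > 0$ *)
Definition poisson_family nu :=
  forall lambda : {posnum R},
    poisson_process (fun D => (lambda%:num)%:E * nu D)%E.

(* "Almost surely" means up to a negligible set, which agrees with probability 1
   when the event is measurable. *)
Definition lambda_e nu (Phi : poisson_family nu) : \bar R :=
  ereal_inf [set (lambda%:num)%:E | lambda in [set lambda : {posnum R} |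
    {ae pp_prob (Phi lambda),
      forall w, vacant (Phi := Phi lambda) w = set0}]].

End critical_value.

(* Main.v *)
Require Import Defs.
From HB Require Import structures.
From mathcomp Require Import all_boot all_order all_algebra.
From mathcomp Require Import all_classical all_reals all_analysis.
From mathcomp Require Import measurable_realfun.
From mathcomp Require Import ring lra.
Set Implicit Arguments.
Unset Strict Implicit.
Unset Printing Implicit Defensive.
Import Order.TTheory GRing.Theory Num.Theory.
Import numFieldNormedType.Exports.
Local Open Scope classical_set_scope.
Local Open Scope ring_scope.

(* For each of the two processes, let [a] be the intensity of the sets that cover
   a given point at one dyadic range of scales. Since boundaries are null, [a] is
   the same for [mu] and for its closure image, and it is the limit as [r -> 0]
   both of the intensity of the sets containing a cube of radius [r] and of that
   of the sets touching it. Both critical values equal [d ln 2 / a]. Above this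
   value, the expected number of cubes of side [2^-k] in a bounded region that
   are not swallowed by a single set tends to 0. Below it, let [Z_k] count the
   points of the grid of step [2^-k] in the unit cube whose neighbourhoods of
   radius [r 2^-j] avoid all sets of size [2^-j], [j < k]. Then
   [E Z_k^2 <= C (E Z_k)^2], so that with probability at least [1/C] there are
   such points for infinitely many [k], and their cluster points are vacant. Only
   the void probabilities of the Poisson processes matter. *)

(** * Cubes and diameters *)

Section cubes.
Context (R : realType) (d : nat).
Implicit Types (x y : 'rV[R]_d) (A : set 'rV[R]_d).

Definition cube x (r : R) : set 'rV[R]_d :=
  [set y | forall i, `|x 0 i - y 0 i| < r].

Definition ccube x (r : R) : set 'rV[R]_d :=
  [set y | forall i, `|x 0 i - y 0 i| <= r].

Lemma cube_sub_ccube x r : cube x r `<=` ccube x r.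
Proof. by move=> y xy i; exact: ltW. Qed.

Lemma cube_center x r : 0 < r -> cube x r x.
Proof. by move=> r0 i; rewrite subrr normr0. Qed.

Lemma ccube_neq0 x r : 0 < r -> ccube x r !=set0.
Proof. by move=> r0; exists x; apply: cube_sub_ccube; exact: cube_center. Qed.

Lemma cube_ball x r : 0 < r -> cube x r = ball x r.
Proof.
move=> r0; apply/seteqP; split => y.
  by move=> xy; split=> // i j; rewrite ord1; exact: xy.
by move=> [_ xy] i; exact: xy.
Qed.

Lemma nbhs_cube x r : 0 < r -> nbhs x (cube x r).
Proof. by move=> r0; rewrite cube_ball//; exact: nbhsx_ballx. Qed.

Lemma nbhs_cubeP x A : nbhs x A <-> exists2 r : R, 0 < r & cube x r `<=` A.
Proof.
split=> [/nbhs_ballP[r/= r0 xA]|[r r0 xA]].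
  by exists r => //; rewrite cube_ball.
by apply: filterS xA _; exact: nbhs_cube.
Qed.

Lemma open_cube x r : 0 < r -> open (cube x r).
Proof. by move=> r0; rewrite cube_ball//; exact: ball_open. Qed.

Lemma compact_ccube x r : compact (ccube x r).
Proof.
have -> : ccube x r =
    [set v : 'rV[R]_d | forall i, `[x 0 i - r, x 0 i + r]%classic (v ord0 i)].
  apply/seteqP; split=> y xy i; have := xy i; rewrite /= in_itv/= ler_distlC; done.
apply: (@rV_compact _ d (fun i => `[x 0 i - r, x 0 i + r]%classic)) => i.
exact: segment_compact.
Qed.

Lemma bounded_ccube x r : bounded_set (ccube x r).
Proof. exact: compact_bounded (@compact_ccube x r). Qed.

Lemma bounded_cube x r : bounded_set (cube x r).
Proof.
have [M [Mr xM]] := bounded_ccube x r; exists M; split => // N MN y xy.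
exact: xM _ MN _ (cube_sub_ccube xy).
Qed.

Lemma in_ccube x : exists M : nat, ccube 0 M%:R x.
Proof.
exists (Num.bound (\sum_i `|x 0 i|)) => i; rewrite mxE sub0r normrN.
apply: le_trans (ltW (archi_boundP _)); last by apply: sumr_ge0.
by rewrite (bigD1 i)//= lerDl sumr_ge0.
Qed.

Lemma open_open_box (ab : 'rV[R]_d * 'rV[R]_d) : open (open_box ab).
Proof.
rewrite openE => y xy; exists (fun _ j => `]ab.1 0 j, ab.2 0 j[%classic).
  move=> i j; rewrite ord1; apply: open_nbhs_nbhs; split.
    exact: itv_open.
  by rewrite /= in_itv/=; exact: xy.
by move=> z yz i; have := yz 0 i; rewrite /= in_itv.
Qed.

Lemma norm_le_edist x y i : `|x 0 i - y 0 i| <= Defs.edist x y.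
Proof.
rewrite /Defs.edist -sqrtr_sqr ler_sqrt; last by apply: sumr_ge0 => j _; exact: sqr_ge0.
by rewrite (bigD1 i)//= lerDl sumr_ge0// => j _; exact: sqr_ge0.
Qed.

Lemma edistDl (z x y : 'rV[R]_d) : Defs.edist (z + x) (z + y) = Defs.edist x y.
Proof.
by congr Num.sqrt; apply: eq_bigr => i _; rewrite !mxE opprD addrACA subrr add0r.
Qed.

Lemma edistZ (s : R) x y : 0 <= s -> Defs.edist (s *: x) (s *: y) = s * Defs.edist x y.
Proof.
move=> s0; rewrite /Defs.edist -[in RHS](ger0_norm s0) -sqrtr_sqr -sqrtrM ?sqr_ge0//.
rewrite mulr_sumr; congr Num.sqrt; apply: eq_bigr => i _.
by rewrite !mxE -mulrBr exprMn.
Qed.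

Lemma diam_ge0 A : (0 <= diam A)%E.
Proof. by rewrite /diam le_max lexx. Qed.

Lemma diam_ub A x y : A x -> A y -> ((Defs.edist x y)%:E <= diam A)%E.
Proof.
move=> Ax Ay; rewrite /diam le_max; apply/orP; right.
by apply: ereal_sup_ubound; exists (x, y).
Qed.

Lemma diam_le A (r : \bar R) : (0 <= r)%E ->
  (forall x y, A x -> A y -> ((Defs.edist x y)%:E <= r)%E) -> (diam A <= r)%E.
Proof.
move=> r0 Ar; rewrite /diam ge_max r0/=.
by apply: ge_ereal_sup => _ [[x y] [/= Ax Ay] <-]; exact: Ar.
Qed.

Lemma le_diam A B : A `<=` B -> (diam A <= diam B)%E.
Proof.
by move=> AB; apply: diam_le => [|x y /AB Bx /AB By]; [exact: diam_ge0|exact: diam_ub].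
Qed.

Lemma diam_closureE A : diam (closure A) = diam A.
Proof. by apply/le_anti; rewrite diam_closure le_diam//; exact: subset_closure. Qed.

Lemma diam_translate (x : 'rV[R]_d) A : diam [set x + y | y in A] = diam A.
Proof.
apply/le_anti/andP; split; apply: diam_le; rewrite ?diam_ge0//.
  by move=> _ _ [u Au <-] [v Av <-]; rewrite edistDl; exact: diam_ub.
by move=> u v Au Av; rewrite -(edistDl x); apply: diam_ub; [exists u|exists v].
Qed.

Lemma diam_scale (s : R) A : 0 < s -> diam [set s *: y | y in A] = (s%:E * diam A)%E.
Proof.
have le (t : R) (B : set 'rV[R]_d) : 0 < t -> (diam [set t *: y | y in B] <= t%:E * diam B)%E.
  move=> t0; apply: diam_le; first by rewrite mule_ge0 ?diam_ge0// lee_fin ltW.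
  move=> _ _ [u Au <-] [v Av <-]; rewrite edistZ ?(ltW t0)// EFinM.
  by apply: lee_wpmul2l; [rewrite lee_fin ltW|exact: diam_ub].
move=> s0; apply/le_anti; rewrite le//=.
have sA : [set s^-1 *: y | y in [set s *: y | y in A]] = A.
  rewrite image_comp -[RHS]image_id; apply: eq_imagel => y _ /=.
  by rewrite scalerA mulVf ?gt_eqF// scale1r.
have := le s^-1 [set s *: y | y in A]; rewrite invr_gt0 sA => /(_ s0) h.
apply: le_trans (lee_wpmul2l _ h) _; first by rewrite lee_fin ltW.
by rewrite muleA -EFinM divff ?gt_eqF// mul1e.
Qed.

(** Moving a point of [A] by half an admissible radius in all coordinates stays in [A]; [d > 0]
    provides a coordinate in which the two points differ. *)
Lemma diam_gt0 A : (0 < d)%N -> open A -> A !=set0 -> (0 < diam A)%E.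
Proof.
move=> d0 oA [x Ax]; have : nbhs x A by exact: open_nbhs_nbhs.
move=> /nbhs_cubeP[r r0 xA].
pose y := x + const_mx (r / 2).
have Ay : A y.
  by apply: xA => i; rewrite !mxE opprD addrA subrr sub0r normrN gtr0_norm; lra.
apply: lt_le_trans (diam_ub Ax Ay); rewrite lte_fin.
apply: lt_le_trans (norm_le_edist x y (Ordinal d0)).
by rewrite !mxE opprD addrA subrr sub0r normrN gtr0_norm; lra.
Qed.

Lemma closure_meets A B : open B -> closure A `&` B !=set0 -> A `&` B !=set0.
Proof. by move=> oB [x [Ax Bx]]; apply: Ax; exact: open_nbhs_nbhs. Qed.

Lemma closure_cubeP A x :
  closure A x <-> forall r : R, 0 < r -> A `&` cube x r !=set0.
Proof.
split=> [Ax r r0|Ax B /nbhs_cubeP[r r0 xB]]; first by apply: Ax; exact: nbhs_cube.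
by have [y [Ay xy]] := Ax r r0; exists y; split=> //; exact: xB.
Qed.

End cubes.

(** * Dyadic scales and invariance *)

Section shells.
Context (R : realType) (d : nat).
Implicit Types (x y : 'rV[R]_d) (A K : set 'rV[R]_d) (G : small_set R d).

Definition scale (j : nat) : R := 2^-1 ^+ j.

Lemma scale_gt0 j : 0 < scale j.
Proof. by rewrite exprn_gt0// invr_gt0. Qed.

Lemma scaleD i j : scale (i + j) = scale i * scale j.
Proof. exact: exprD. Qed.

Lemma scale_le i j : (i <= j)%N -> scale j <= scale i.
Proof.
by move=> ij; rewrite ler_wiXn2l// ?invr_ge0// invf_le1// ler1n.
Qed.

Lemma scale_le1 j : scale j <= 1.
Proof. exact: (@scale_le 0). Qed.

Lemma scale_cvg0 : scale @ \oo --> 0.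
Proof. by apply: cvg_expr; rewrite gtr0_norm// invf_lt1// ltr1n. Qed.

Lemma scale_lt (r : R) : 0 < r -> exists j, scale j < r.
Proof.
move=> r0; have /cvgrPdist_lt/(_ _ r0)[n _ nP] := scale_cvg0.
exists n; have := nP n (leqnn n); rewrite sub0r normrN gtr0_norm//.
exact: scale_gt0.
Qed.

(** The shell of index [j], in which sizes are comparable to [2^-j]. [Q] is a property of arbitrary
    sets rather than of small ones, so that it can be composed with translations and dilations. *)
Definition annulus (Q : set (set 'rV[R]_d)) j : set (small_set R d) :=
  [set G | Q G /\ ((scale j.+1)%:E <= diam G < (scale j)%:E)%E].

Definition touching A : set (set 'rV[R]_d) := [set G | G `&` A !=set0].

Definition engulfing K : set (set 'rV[R]_d) := [set G | K `<=` G].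

Lemma small_diamE G : exists2 r : R, 0 <= r < 1 & diam G = r%:E.
Proof.
have G1 := small_diam G.
have Gfin : diam G \is a fin_num.
  by rewrite ge0_fin_numE ?diam_ge0//; apply: lt_trans G1 _; rewrite ltry.
exists (fine (diam G)); last by rewrite fineK.
by rewrite -!lee_fin -lte_fin fineK// diam_ge0.
Qed.

Lemma annulus_touching A j :
  annulus (touching A) j = hitting A (scale j.+1) `\` hitting A (scale j).
Proof.
apply/seteqP; split=> G /=.
  by move=> [GA /andP[lG Gl]]; split=> // -[_]; rewrite leNgt Gl.
move=> [[GA lG] nGl]; split=> //; rewrite lG/= ltNge; apply/negP => Gl.
by apply: nGl; split.
Qed.

(** This gives measurability, as both factors are built from events that [suitable] provides. A
    nonempty [K] is touched by every set containing it. *)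
Lemma annulus_engulfing K j : K !=set0 ->
  annulus (engulfing K) j = annulus (touching K) j `&` containing K.
Proof.
move=> [x Kx]; apply/seteqP; split=> G /=.
  by move=> [KG GE]; split=> //; split=> //; exists x; split=> //; exact: KG.
by move=> [[_ GE] KG].
Qed.

Lemma annulus_inj Q Q' i j G : annulus Q i G -> annulus Q' j G -> i = j.
Proof.
move=> [_ /andP[iG Gi]] [_ /andP[jG Gj]].
have {iG Gj} ij := le_lt_trans iG Gj; have {jG Gi} ji := le_lt_trans jG Gi.
case: (ltngtP i j) => // lt.
  by move: ij; rewrite lte_fin ltNge scale_le.
by move: ji; rewrite lte_fin ltNge scale_le.
Qed.

Lemma annulusS Q Q' j : Q `<=` Q' -> annulus Q j `<=` annulus Q' j.
Proof. by move=> QQ' G [/QQ' ? ?]. Qed.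

Lemma annulus_exists G : (0 < diam G)%E ->
  exists j, ((scale j.+1)%:E <= diam G < (scale j)%:E)%E.
Proof.
have [r /andP[r0 r1] ->] := small_diamE G; rewrite lte_fin => {}r0.
have ex : exists j, scale j <= r by have [j /ltW jr] := scale_lt r0; exists j.
(* The minimal index is a successor because a small set has diameter below [1 = scale 0]. *)
case: (ex_minnP ex) => -[|j jr jmin]; first by rewrite /scale expr0 leNgt r1.
exists j; rewrite lee_fin lte_fin jr/= ltNge; apply/negP => /jmin.
by rewrite ltnn.
Qed.

(** Dilation by [2^-j] multiplies diameters by [2^-j]. Conversely, a set of shell [j] blown up by
    [2^j] has diameter below 1, so it is again a small set. *)
Lemma small_rescale_annulus Q j : small_rescale (scale j) (annulus Q 0) =
  annulus (fun A => Q [set (scale j)^-1 *: y | y in A]) j.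
Proof.
have j0 := scale_gt0 j.
have jE (r : R) : (scale 1 <= (scale j)^-1 * r < scale 0) =
    (scale j.+1 <= r < scale j).
  by rewrite ler_pdivlMl// ltr_pdivrMl// -!scaleD addn1 addn0.
apply/seteqP; split=> G /=.
  move=> [H [QH HE] HG]; split; first by rewrite -HG.
  move: HE; rewrite HG diam_scale ?invr_gt0//.
  by have [r _ ->] := small_diamE G; rewrite -EFinM !lee_fin !lte_fin jE.
move=> [QG GE]; have G1 : (diam [set (scale j)^-1 *: y | y in small_val G] < 1)%E.
  rewrite diam_scale ?invr_gt0//; move: GE.
  have [r _ ->] := small_diamE G; rewrite -EFinM !lee_fin !lte_fin -jE.
  by case/andP.
exists (SmallSet G1) => //; split=> //=.
rewrite diam_scale ?invr_gt0//; move: GE.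
by have [r _ ->] := small_diamE G; rewrite -EFinM !lee_fin !lte_fin jE.
Qed.

Lemma image_translateK x A : [set y - x | y in [set x + y | y in A]] = A.
Proof.
rewrite image_comp -[RHS]image_id; apply: eq_imagel => y _ /=.
by rewrite addrC addKr.
Qed.

Lemma translate_annulus x Q j :
  translate x (annulus Q j) = annulus (fun A => Q [set y - x | y in A]) j.
Proof.
apply/seteqP; split=> G /=.
  move=> [H [QH HE] GH]; split; first by rewrite GH image_translateK.
  by rewrite GH diam_translate.
move=> [QG GE].
have GK : [set x + y | y in [set y - x | y in small_val G]] = small_val G.
  rewrite image_comp -[RHS]image_id; apply: eq_imagel => y _ /=.
  by rewrite addrC subrK.
have Gd : diam [set y - x | y in small_val G] = diam G.
  by rewrite -(diam_translate x) GK.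
have G1 : (diam [set (y - x)%R | y in small_val G] < 1)%E.
  by rewrite Gd; exact: small_diam.
by exists (SmallSet G1) => //; split=> //=; rewrite Gd.
Qed.

Lemma rescalable_scale j (D : set (small_set R d)) : rescalable (scale j) D.
Proof.
have j0 := scale_gt0 j; split=> // A [H _ HA].
have [r /andP[_ r1] Hr] := small_diamE H.
have -> : A = [set scale j *: y | y in small_val H].
  rewrite HA image_comp -[LHS]image_id; apply: eq_imagel => y _ /=.
  by rewrite scalerA divff ?gt_eqF// scale1r.
rewrite diam_scale// Hr -EFinM lte_fin; apply: le_lt_trans r1.
have [r0|r0] := leP 0 r; first by rewrite ler_piMl// scale_le1.
by have := diam_ge0 (small_val H); rewrite Hr lee_fin leNgt r0.
Qed.

(** The map [y |-> 2^j (y - x)] normalises a cube at [x] in scale [j] to a cube at the origin in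
    scale 0. This equivalence and the next one are fed to [mu_annulus]. *)
Lemma touching_affine x (r : R) j A :
  touching (cube x (r * scale j)) A <->
  touching (cube 0 r) [set (scale j)^-1 *: (y - x) | y in A].
Proof.
have s0 := scale_gt0 j.
have E y i : (`|(0 : 'rV[R]_d) 0 i - ((scale j)^-1 *: (y - x)) 0 i| < r)
    = (`|x 0 i - y 0 i| < r * scale j).
  rewrite !mxE sub0r normrN normrM gtr0_norm ?invr_gt0//.
  by rewrite ltr_pdivrMl// distrC mulrC.
split.
  move=> [y [Ay xy]]; exists ((scale j)^-1 *: (y - x)); split; first by exists y.
  by move=> i; rewrite E.
by move=> [_ [[y Ay <-] xy]]; exists y; split=> // i; rewrite -E.
Qed.

Lemma engulfing_affine x (r : R) j A :
  engulfing (ccube x (r * scale j)) A <->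
  engulfing (ccube 0 r) [set (scale j)^-1 *: (y - x) | y in A].
Proof.
have s0 := scale_gt0 j.
have E y i : (`|(0 : 'rV[R]_d) 0 i - ((scale j)^-1 *: (y - x)) 0 i| <= r)
    = (`|x 0 i - y 0 i| <= r * scale j).
  rewrite !mxE sub0r normrN normrM gtr0_norm ?invr_gt0//.
  by rewrite ler_pdivrMl// distrC mulrC.
split.
  move=> cA z z0.
  have zE : z = (scale j)^-1 *: ((scale j *: z + x) - x).
    by rewrite addrK scalerA mulVf ?gt_eqF// scale1r.
  exists (scale j *: z + x) => //; apply: cA => i.
  by rewrite -E -zE.
move=> cA y xy.
have : [set (scale j)^-1 *: (y - x) | y in A] ((scale j)^-1 *: (y - x)).
  by apply: cA => i; rewrite E.
move=> [z Az /(congr1 (fun z => scale j *: z))].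
by rewrite !scalerA divff ?gt_eqF// !scale1r => /addIr <-.
Qed.

(** Only countably many cubes are involved, here and for the interior, so both properties become
    measurable and accessible to monotone continuity of the measure. *)
Lemma closureP x A :
  closure A x <-> forall m, touching (cube x (scale m)) A.
Proof.
rewrite closure_cubeP; split=> [Ax m|Ax r r0]; first exact: Ax (scale_gt0 m).
have [m mr] := scale_lt r0; have [y [Ay xy]] := Ax m.
by exists y; split=> // i; exact: lt_trans (xy i) mr.
Qed.

Lemma interiorP x A :
  A° x <-> exists m, engulfing (ccube x (scale m)) A.
Proof.
split=> [/nbhs_cubeP[r r0 xA]|[m mA]].
  have [m mr] := scale_lt r0; exists m => y xy; apply: xA => i.
  exact: le_lt_trans (xy i) mr.
apply/nbhs_cubeP; exists (scale m); first exact: scale_gt0.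
by move=> y /cube_sub_ccube/mA.
Qed.

Lemma ccube_diam G x : closure G x -> closure G `<=` ccube x 1.
Proof.
move=> Gx y Gy i; apply: le_trans (norm_le_edist x y i) _.
rewrite -lee_fin; apply: le_trans (diam_ub Gx Gy) _.
by rewrite diam_closureE ltW//; exact: small_diam.
Qed.

Lemma compact_boundary G : compact (boundary G).
Proof.
have [->|/set0P[x [Gx _]]] := eqVneq (boundary G) set0; first exact: compact0.
apply: (subclosed_compact _ (@compact_ccube R d x 1)).
  rewrite /boundary setDE; apply: closedI; first exact: closed_closure.
  by apply: open_closedC; exact: open_interior.
by move=> y [Gy _]; exact: ccube_diam Gx _ Gy.
Qed.

End shells.

(** * Invariance and finiteness of the intensities of shells *)

Section intensity.
Context (R : realType) (d : nat) (F : set (set (small_set R d))).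
Context (F_suitable : suitable F).
Implicit Types (x y : 'rV[R]_d) (A K : set 'rV[R]_d) (G : small_set R d).
Local Notation T := (g_sigma_algebraType F).

Lemma measurableF (D : set T) : measurable D = F D.
Proof.
have /measurable_g_measurableTypeE := suitable_sigma_algebra F_suitable.
exact: (congr1 (fun M => M D)).
Qed.

Lemma measurable_hitting A (r : R) : bounded_set A -> 0 < r ->
  measurable (hitting A r : set T).
Proof. by rewrite measurableF; exact: suitable_hitting. Qed.

Lemma measurable_touching A j : bounded_set A ->
  measurable (annulus (touching A) j : set T).
Proof.
move=> bA; rewrite annulus_touching.
by apply: measurableD; apply: measurable_hitting => //; exact: scale_gt0.
Qed.

Lemma measurable_engulfing K j : compact K -> K !=set0 ->
  measurable (annulus (engulfing K) j : set T).
Proof.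
move=> cK K0; rewrite annulus_engulfing//; apply: measurableI.
  by apply: measurable_touching; exact: compact_bounded.
by rewrite measurableF; exact: suitable_containing.
Qed.

Section measure.
Context (mu : {measure set T -> \bar R}).
Context (mu_translation : translation_invariant mu).
Context (mu_scale : semi_scale_invariant mu).
Context (mu_hitting : forall (A : set 'rV[R]_d) (delta : R),
  bounded_set A -> 0 < delta -> (mu (hitting A delta) < +oo)%E).
(** Semi scale invariance carries shell 0 to shell [j], then translation invariance carries the
    origin to [x]. Finiteness is demanded by semi scale invariance. *)
Lemma mu_annulus (Q Q' : set (set 'rV[R]_d)) j x :
  measurable (annulus Q 0 : set T) -> (mu (annulus Q 0) < +oo)%E ->
  (forall A, Q' A <-> Q [set (scale R j)^-1 *: (y - x) | y in A]) ->
  mu (annulus Q' j) = mu (annulus Q 0).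
Proof.
move=> mQ Qoo QQ'.
have mD : measurable (small_rescale (scale R j) (annulus Q 0) : set T).
  move: mQ; rewrite !measurableF => mQ.
  by apply: suitable_rescale => //; exact: rescalable_scale.
rewrite -(mu_scale mQ Qoo (rescalable_scale j _)) -(mu_translation x mD).
congr (mu _); rewrite small_rescale_annulus translate_annulus; congr annulus.
apply/seteqP; split=> A; rewrite /= image_comp => /QQ'//.
Qed.

Lemma mu_annulus_lty (Q : set (set 'rV[R]_d)) A j :
  bounded_set A -> Q `<=` touching A -> measurable (annulus Q j : set T) ->
  (mu (annulus Q j) < +oo)%E.
Proof.
move=> bA QA mQ; apply: le_lt_trans (mu_hitting bA (scale_gt0 R j.+1)).
apply: le_measure; rewrite ?inE//.
  by apply: measurable_hitting => //; exact: scale_gt0.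
by move=> G [/QA AG /andP[]].
Qed.

Lemma mu_touching_cube x (r : R) j : 0 < r ->
  mu (annulus (touching (cube x (r * scale R j))) j) =
  mu (annulus (touching (cube 0 r)) 0).
Proof.
move=> r0; apply: (@mu_annulus _ _ _ x).
- by apply: measurable_touching; exact: bounded_cube.
- apply: (mu_annulus_lty (bounded_cube 0 r)) => //.
  by apply: measurable_touching; exact: bounded_cube.
- by move=> A; exact: touching_affine.
Qed.

Lemma mu_engulfing_cube x (r : R) j : 0 < r ->
  mu (annulus (engulfing (ccube x (r * scale R j))) j) =
  mu (annulus (engulfing (ccube 0 r)) 0).
Proof.
move=> r0; have c0 := ccube_neq0 (0 : 'rV[R]_d) r0.
have m0 : measurable (annulus (engulfing (ccube 0 r)) 0 : set T).
  by apply: measurable_engulfing => //; exact: compact_ccube.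
apply: (@mu_annulus _ _ _ x) => //.
- apply: (mu_annulus_lty (bounded_ccube 0 r)) => //.
  by have [z z0] := c0; move=> A cA; exists z; split=> //; exact: cA.
- by move=> A; exact: engulfing_affine.
Qed.

End measure.
End intensity.

(** * Touching and containing a point have the same intensity *)

Section grids.
Context (R : realType) (d : nat).
Implicit Types (x : 'rV[R]_d) (K : set 'rV[R]_d).

(** Between the least element [u] and the greatest element [v] there are [v - u + 1] integers, and
    [v - u < b - a]. The hypothesis [a <= b] settles the case of an empty [S]. *)
Lemma card_ord_itv n (S : {pred 'I_n}) (a b : R) : a <= b ->
  (forall u : 'I_n, u \in S -> a < u%:R < b) -> #|S|%:R <= b - a + 1.
Proof.
move=> ab Sab; case: (pickP [pred u | u \in S]) => [u0 Su0|S0]; last first.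
  by rewrite eq_card0//; lra.
case: (arg_minnP (fun u : 'I_n => u : nat) Su0) => u Su umin.
case: (arg_maxnP (fun u : 'I_n => u : nat) Su0) => v Sv vmax.
have uv : (u <= v)%N by exact: umin.
have : (#|S| <= (v - u).+1)%N.
  rewrite cardE -(size_map (@nat_of_ord n)) -(size_iota u (v - u).+1).
  apply: uniq_leq_size; first by rewrite map_inj_uniq ?enum_uniq//; exact: val_inj.
  move=> x /mapP[w]; rewrite mem_enum => Sw ->.
  by rewrite mem_iota addnS subnKC// ltnS umin//; exact: vmax.
rewrite -(ler_nat R) => /le_trans; apply.
rewrite -natr1 natrB//; have := Sab _ Su; have := Sab _ Sv; lra.
Qed.

Definition grid (c e : R) n (f : {ffun 'I_d -> 'I_n}) : 'rV[R]_d :=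
  \row_i (c + e * (f i)%:R).

Lemma grid_in_ccube n (f : {ffun 'I_d -> 'I_(2 ^ n)}) :
  ccube 0 1 (grid 0 (scale R n) f).
Proof.
move=> i; rewrite !mxE !add0r normrN ger0_norm; last first.
  by rewrite mulr_ge0// exprn_ge0// invr_ge0.
rewrite /scale exprVn mulrC ler_pdivrMr ?exprn_gt0// mul1r -natrX ler_nat.
exact: ltnW.
Qed.

Lemma card_ffun_prod n (S : 'I_d -> {pred 'I_n}) :
  #|[pred f : {ffun 'I_d -> 'I_n} | [forall i, f i \in S i]]| =
  (\prod_i #|S i|)%N.
Proof.
transitivity #|(family S : simpl_pred {ffun 'I_d -> 'I_n})|.
  by apply: eq_card => f; rewrite !inE.
by rewrite card_family foldrE big_map big_enum.
Qed.

Lemma card_grid_open_box (c e : R) n (ab : 'rV[R]_d * 'rV[R]_d) : 0 < e ->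
  (forall i, ab.1 0 i <= ab.2 0 i) ->
  #|[pred f : {ffun 'I_d -> 'I_n} | `[< open_box ab (grid c e f) >]]|%:R <=
  \prod_i ((ab.2 0 i - ab.1 0 i) / e + 1).
Proof.
move=> e0 ab12.
pose S i := [pred u : 'I_n | ab.1 0 i < c + e * u%:R < ab.2 0 i].
have -> : #|[pred f : {ffun 'I_d -> 'I_n} | `[< open_box ab (grid c e f) >]]| =
    (\prod_i #|S i|)%N.
  rewrite -card_ffun_prod; apply: eq_card => f; rewrite !inE.
  apply/asboolP/forallP => fS i; have := fS i; by rewrite mxE.
rewrite natr_prod; apply: ler_prod => i _; rewrite ler0n/=.
have -> : (ab.2 0 i - ab.1 0 i) / e =
    (ab.2 0 i - c) / e - (ab.1 0 i - c) / e.
  by rewrite -mulrBl opprB addrA subrK.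
apply: card_ord_itv => [|u].
  by rewrite ler_pM2r ?invr_gt0// lerD2r.
by rewrite inE ltr_pdivrMr// ltr_pdivlMr// ltrBlDl ltrBrDl mulrC.
Qed.

(** By compactness, finitely many open boxes of small total volume cover [K]. A box with sides [l_i]
    holds at most [prod (l_i / e + 1)] points of the grid of step [e], and [e^d] times this tends to
    its volume. *)
Lemma grid_density_cvg0 K : compact K -> (lebesgue K <= 0)%E ->
  (fun n => #|[pred f : {ffun 'I_d -> 'I_(2 ^ n)} |
      `[< K (grid 0 (scale R n) f) >]]|%:R * scale R n ^+ d) @ \oo --> (0 : R).
Proof.
move=> cK K0; apply/cvgrPdist_lt => /= eps eps0.
have : (lebesgue K < eps%:E)%E by apply: le_lt_trans K0 _; rewrite lte_fin.
move=> /ereal_inf_lt[_ /= [ab [ab12 Kab] <-] vol].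
have vol0 k : 0 <= box_volume (ab k).
  by apply: prodr_ge0 => i _; rewrite subr_ge0.
have [N KN] : exists N, K `<=` \bigcup_(k in `I_N) open_box (ab k).
  move: cK; rewrite compact_cover => /(_ nat setT (fun k => open_box (ab k))).
  case=> [k _|x Kx|D _ KD]; first exact: open_open_box.
    by have [k _ xk] := Kab _ Kx; exists k.
  exists (\max_(k <- finmap.enum_fset D) k).+1 => x /KD[k /= Dk xk]; exists k => //=.
  by rewrite ltnS; exact: leq_bigmax_seq.
have volN : \sum_(k < N) box_volume (ab k) < eps.
  rewrite -lte_fin; apply: le_lt_trans vol; rewrite -sumEFin.
  rewrite -(big_mkord xpredT (fun k => (box_volume (ab k))%:E)).
  by apply: nneseries_lim_ge => k _ _; rewrite lee_fin.
have cvgN : (fun n => \sum_(k < N) \prod_i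
    ((ab k).2 0 i - (ab k).1 0 i + scale R n)) @ \oo -->
    \sum_(k < N) box_volume (ab k).
  apply: cvg_big => [|k _]; first exact: add_continuous.
  apply: cvg_big => [|i _]; first exact: mul_continuous.
  rewrite -[X in _ --> X]addr0; apply: cvgD; first exact: cvg_cst.
  exact: scale_cvg0.
have : \forall n \near \oo, \sum_(k < N) \prod_i
    ((ab k).2 0 i - (ab k).1 0 i + scale R n) < eps.
  exact: cvgr_lt cvgN _ volN.
apply: filterS => n; rewrite sub0r normrN.
have s0 := scale_gt0 R n.
rewrite ger0_norm; last by rewrite mulr_ge0// exprn_ge0// ltW.
apply: le_lt_trans.
have boxn k : #|[pred f : {ffun 'I_d -> 'I_(2 ^ n)} |
      `[< open_box (ab k) (grid 0 (scale R n) f) >]]|%:R * scale R n ^+ d <=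
    \prod_i ((ab k).2 0 i - (ab k).1 0 i + scale R n).
  have -> : \prod_i ((ab k).2 0 i - (ab k).1 0 i + scale R n) =
      (\prod_i (((ab k).2 0 i - (ab k).1 0 i) / scale R n + 1)) * scale R n ^+ d.
    rewrite -[X in _ ^+ X]card_ord -prodr_const -big_split/=; apply: eq_bigr => i _.
    by rewrite mulrDl mul1r divfK// gt_eqF.
  by apply: ler_wpM2r; [rewrite exprn_ge0// ltW|exact: card_grid_open_box].
apply: le_trans (ler_sum _ (fun (k : 'I_N) _ => boxn k)).
rewrite -mulr_suml ler_wpM2r//; first by rewrite exprn_ge0// ltW.
rewrite -natr_sum ler_nat.
(* Every grid point of [K] is counted by at least one of the [N] boxes; the two summations are then
   exchanged. *)
rewrite -sum1_card.
apply: (@leq_trans (\sum_(f : {ffun 'I_d -> 'I_(2 ^ n)})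
    \sum_(k < N) `[< open_box (ab k) (grid 0 (scale R n) f) >])).
  rewrite big_mkcond leq_sum// => f _; case: ifPn => //; rewrite inE => /KN[k kN xk].
  by rewrite (bigD1 (Ordinal kN))//= (introT (asboolP _) xk).
rewrite exchange_big leq_sum// => k _; rewrite -sum1_card [leqRHS]big_mkcond/=.
by apply: leq_sum => f _; rewrite inE; case: asboolP.
Qed.

End grids.

Section boundary.
Context (R : realType) (d : nat) (F : set (set (small_set R d))).
Context (F_suitable : suitable F).
Implicit Types (x y : 'rV[R]_d) (A K : set 'rV[R]_d) (G : small_set R d).
Local Notation T := (g_sigma_algebraType F).
Context (mu : {measure set T -> \bar R}).
Context (mu_translation : translation_invariant mu).
Context (mu_scale : semi_scale_invariant mu).
Context (mu_hitting : forall (A : set 'rV[R]_d) (delta : R),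
  bounded_set A -> 0 < delta -> (mu (hitting A delta) < +oo)%E).
Definition at_boundary x : set (small_set R d) := annulus (fun A => boundary A x) 0.

Lemma annulus_closure x j : annulus (fun A => closure A x) j =
  \bigcap_m annulus (touching (cube x (scale R m))) j.
Proof.
apply/seteqP; split=> G.
  by move=> [/closureP Gx GE] m _; split.
by move=> Gx; split; [apply/closureP => m|]; [have [] := Gx m I|have [] := Gx 0%N I].
Qed.

Lemma annulus_interior x j : annulus (fun A => A° x) j =
  \bigcup_m annulus (engulfing (ccube x (scale R m))) j.
Proof.
apply/seteqP; split=> G.
  by move=> [/interiorP[m Gx] GE]; exists m.
by move=> [m _ [mG GE]]; split=> //; apply/interiorP; exists m.
Qed.

Lemma measurable_annulus_closure x j :
  measurable (annulus (fun A => closure A x) j : set T).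
Proof.
rewrite annulus_closure; apply: bigcap_measurable => [|m _]; first by exists 0%N.
by apply: measurable_touching => //; exact: bounded_cube.
Qed.

Lemma measurable_annulus_interior x j :
  measurable (annulus (fun A => A° x) j : set T).
Proof.
rewrite annulus_interior; apply: bigcup_measurable => m _.
by apply: measurable_engulfing => //; [exact: compact_ccube|exact: ccube_neq0 (scale_gt0 R m)].
Qed.

Lemma at_boundaryE x : at_boundary x =
  annulus (fun A => closure A x) 0 `\` annulus (fun A => A° x) 0.
Proof.
apply/seteqP; split=> G.
  by move=> [[cG iG] GE]; split=> // -[].
by move=> [[cG GE] iG]; split=> //; split=> // iGx; apply: iG.
Qed.

Lemma measurable_at_boundary x : measurable (at_boundary x : set T).
Proof.
rewrite at_boundaryE; apply: measurableD.
  exact: measurable_annulus_closure.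
exact: measurable_annulus_interior.
Qed.

Lemma mu_at_boundary x : mu (at_boundary x) = mu (at_boundary 0).
Proof.
apply: (@mu_annulus _ _ _ F_suitable mu _ _ (fun A => boundary A 0) _ 0 x) => //.
- exact: measurable_at_boundary.
- apply: (@mu_annulus_lty _ _ _ F_suitable mu _ _ (cube 0 1)) => //.
  + exact: bounded_cube.
  + by move=> A [/closureP/(_ 0%N)].
  + exact: measurable_at_boundary.
- have closE A z (B := [set (scale R 0)^-1 *: (y - z) | y in A]) :
      (closure A z <-> closure B 0) /\ (A° z <-> B° 0).
    have tE m : touching (cube z (scale R m)) A <-> touching (cube 0 (scale R m)) B.
      by have := touching_affine z (scale R m) 0 A; rewrite mulr1.
    have eE m : engulfing (ccube z (scale R m)) A <-> engulfing (ccube 0 (scale R m)) B.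
      by have := engulfing_affine z (scale R m) 0 A; rewrite mulr1.
    rewrite !closureP !interiorP; split; split.
    - by move=> Ax m; apply/tE.
    - by move=> Ax m; apply/tE.
    - by move=> [m /eE mA]; exists m.
    - by move=> [m /eE mA]; exists m.
  move=> A; have [Ac Ai] := closE A x.
  by split=> -[/Ac cA iA]; split=> // /Ai.
Qed.

(** A discrete form of Fubini's theorem. The average over grid points [x] of [mu (at_boundary x)] is
    [mu (at_boundary 0)] by translation invariance; it is also the integral of the proportion of
    grid points on the boundary, which tends to 0 by dominated convergence. *)
Lemma boundary_null : mu (@fat_boundary R d) = 0%E -> mu (at_boundary 0) = 0%E.
Proof.
(* A domain of finite measure carrying all the integrands: a set with a boundary point in the unit
   cube comes within distance 1 of that point, hence meets the cube of radius 2. *)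
move=> mu0; pose W : set T := hitting (ccube 0 2) (scale R 1).
have s0 := scale_gt0 R.
have mW : measurable W by apply: measurable_hitting => //; exact: bounded_ccube.
have Wfin : (mu W < +oo)%E by apply: mu_hitting => //; exact: bounded_ccube.
pose pts n := {ffun 'I_d -> 'I_(2 ^ n)}.
pose B n (f : pts n) : set T := at_boundary (grid 0 (scale R n) f).
have mB n f : measurable (@B n f) by exact: measurable_at_boundary.
have BW n f : @B n f `<=` W.
  move=> G [[/closureP/(_ 0%N)[y [Gy xy]] _] /andP[GE _]]; split=> //.
  exists y; split=> // i; have := xy i; have := @grid_in_ccube R d n f i.
  by rewrite /scale expr0 ltr_norml !ler_norml !mxE; lra.
(* For [G] in shell 0, the proportion of grid points lying on the boundary of [G]. *)
pose Z n G := ((\sum_(f : pts n) \1_(B n f) G) * scale R n ^+ d).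
have cardpts n : #|{: pts n}|%:R * scale R n ^+ d = 1.
  rewrite card_ffun !card_ord !natrX /scale -!exprMn divff.
    by rewrite !expr1n.
  by rewrite pnatr_eq0.
have Z0 n G : 0 <= Z n G.
  by rewrite mulr_ge0 ?exprn_ge0 ?(ltW (s0 _))// sumr_ge0// => f _; rewrite indicE.
have Z1 n G : Z n G <= 1.
  rewrite -(cardpts n) ler_wpM2r ?exprn_ge0 ?(ltW (s0 _))// -sum1_card natr_sum.
  by apply: ler_sum => f _; rewrite indicE lern1 leq_b1.
have mZ n : measurable_fun W (fun G => (\sum_(f : pts n) (\1_(B n f) G)%:E)%E).
  apply: emeasurable_sum => f; apply/measurable_EFinP.
  exact: measurable_indic.
have ZE n : (fun G => (Z n G)%:E) =
    (fun G => (\sum_(f : pts n) (\1_(B n f) G)%:E) * (scale R n ^+ d)%:E)%E.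
  by apply/funext => G; rewrite /Z EFinM sumEFin.
have [p pE] : exists p, mu (at_boundary 0) = p%:E.
  exists (fine (mu (at_boundary 0))); rewrite fineK// ge0_fin_numE//.
  have f0 : pts 0%N := [ffun=> ord0].
  rewrite -(mu_at_boundary (grid 0 (scale R 0) f0)).
  apply: le_lt_trans Wfin; apply: le_measure; rewrite ?inE.
  - exact: (@mB 0%N f0).
  - exact: mW.
  - exact: (@BW 0%N f0).
have IZ n : (\int[mu]_(G in W) (Z n G)%:E = mu (at_boundary 0))%E.
  rewrite ZE ge0_integralZr//; last 2 first.
  - by move=> G _; apply: sume_ge0 => f _; rewrite lee_fin indicE.
  - by rewrite lee_fin exprn_ge0// ltW.
  rewrite ge0_integral_sum//; last first.
    by move=> f; apply/measurable_EFinP; exact: measurable_indic.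
  rewrite (eq_bigr (fun=> mu (at_boundary 0))); last first.
    move=> f _; rewrite integral_indic//.
    by rewrite (setIidl (@BW n f)); exact: mu_at_boundary.
  by rewrite pE sumEFin sumr_const -EFinM -mulr_natl mulrAC cardpts mul1r.
have : (fun n => \int[mu]_(G in W) (Z n G)%:E)%E @ \oo --> (\int[mu]_(G in W) (cst 0 G))%E.
  have : mu.-integrable W (fun=> 1%E).
    apply/integrableP; split; first exact: measurable_cst.
    by under eq_integral do rewrite abse1; rewrite integral_cst// mul1e.
  move=> iW; have [] := @dominated_convergence _ _ _ mu W mW
    (fun n G => (Z n G)%:E) (cst 0%E) (fun=> 1%E) _ _ _ iW _ => //.
  - move=> n; rewrite ZE; apply: emeasurable_funM => //; exact: measurable_cst.
  - exists (@fat_boundary R d); split.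
    + by rewrite (measurableF F_suitable); exact: suitable_boundary.
    + exact: mu0.
    move=> G /= nG; apply: contrapT => nfG; apply: nG => _.
    suff ZG : (fun n => Z n G) @ \oo --> (0 : R).
      by apply: cvg_EFin ZG; near=> n.
    have bG : (lebesgue (boundary G) <= 0)%E by rewrite leNgt; exact/negP.
    apply: squeeze_cvgr (cvg_cst 0) (grid_density_cvg0 (@compact_boundary R d G) bG).
    apply: nearW => n; rewrite /= Z0/= /Z ler_wpM2r ?exprn_ge0 ?(ltW (s0 _))//.
    rewrite -sum1_card natr_sum [leRHS]big_mkcond/=.
    apply: ler_sum => f _; rewrite indicE; case: ifPn => [_|/negP nf].
      by rewrite ler_nat leq_b1.
    rewrite memNset// => -[bf _]; apply: nf; rewrite inE; exact: bf.
  - by apply/aeW => G n _; rewrite gee0_abs lee_fin.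
rewrite (_ : (fun _ => _) = cst (mu (at_boundary 0))); last first.
  by apply/funext => n; rewrite IZ.
by rewrite integral0 => /cvg_lim <-//; rewrite lim_cst.
Unshelve. all: by end_near. Qed.

End boundary.

Section density.
Context (R : realType) (d : nat) (F : set (set (small_set R d))).
Context (F_suitable : suitable F).
Local Notation T := (g_sigma_algebraType F).
Context (mu : {measure set T -> \bar R}).
Context (mu_translation : translation_invariant mu).
Context (mu_scale : semi_scale_invariant mu).
Context (mu_hitting : forall (A : set 'rV[R]_d) (delta : R),
  bounded_set A -> 0 < delta -> (mu (hitting A delta) < +oo)%E).
(* The intensity of the sets of diameter at least 1/2 that cover the origin: the
   expected number of sets covering a point in each dyadic range of scales.
   Closures are harmless since boundaries carry no volume. *)
Definition cover_rate : \bar R := mu (annulus (fun A => closure A 0) 0).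

Lemma cover_rate_ge0 : (0 <= cover_rate)%E.
Proof. exact: measure_ge0. Qed.

Lemma cover_rate_fin_num : cover_rate \is a fin_num.
Proof.
rewrite ge0_fin_numE ?cover_rate_ge0//.
apply: (mu_annulus_lty F_suitable mu_hitting (bounded_cube 0 1)).
  by move=> A /closureP/(_ 0%N).
exact: measurable_annulus_closure.
Qed.

(** Continuity from above along shrinking cubes, starting from a family of finite measure. *)
Lemma touching_lt_cover_rate (c : \bar R) : (cover_rate < c)%E ->
  exists m, (mu (annulus (touching (cube 0 (scale R m))) 0) < c)%E.
Proof.
have mt m : measurable (annulus (touching (cube 0 (scale R m))) 0 : set T).
  by apply: measurable_touching => //; exact: bounded_cube.
rewrite /cover_rate annulus_closure => ac.
have [] := @nonincreasing_cvg_mu _ _ _ mu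
  (fun m => annulus (touching (cube 0 (scale R m))) 0) _ mt _ _ [set x | x < c]%E.
- apply: (mu_annulus_lty F_suitable mu_hitting (bounded_cube 0 1)).
    by [].
  exact: (mt 0%N).
- by apply: bigcap_measurable => [|m _]; [exists 0%N|exact: mt].
- move=> m n mn; apply/subsetPset; apply: annulusS => A [x [Ax x0]].
  by exists x; split=> // i; apply: lt_le_trans (x0 i) _; exact: scale_le.
- by apply: open_nbhs_nbhs; split=> //; exact: open_ereal_lt_ereal.
- by move=> m _ /(_ m (leqnn m)) mc; exists m.
Qed.

(** The closure may be replaced by the interior, as the difference is the null family
    [at_boundary 0]. Then continuity from below applies: a set with 0 in its interior engulfs all
    small enough cubes. *)
Lemma engulfing_gt_cover_rate (c : \bar R) : mu (@fat_boundary R d) = 0%E ->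
  (c < cover_rate)%E ->
  exists m, (c < mu (annulus (engulfing (ccube 0 (scale R m))) 0))%E.
Proof.
move=> mu0.
have mt m : measurable (annulus (engulfing (ccube 0 (scale R m))) 0 : set T).
  apply: measurable_engulfing => //; first exact: (@compact_ccube R d).
  exact: ccube_neq0 (scale_gt0 R m).
have -> : cover_rate = mu (annulus (fun A => A° 0) 0).
  rewrite -(@measureU0 _ _ _ mu _ (at_boundary (0 : 'rV[R]_d) : set T)).
  - congr (mu _); apply/seteqP; split=> G.
      move=> [cG GE]; have [iG|iG] := pselect ((small_val G)° 0); first by left.
      by right.
    move=> [[iG GE]|[[cG _] GE]]; split=> //.
    by apply: subset_closure; exact: interior_subset.
  - exact: measurable_annulus_interior.
  - exact: measurable_at_boundary.
  - exact: boundary_null.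
rewrite annulus_interior => ac.
have [] := @nondecreasing_cvg_mu _ _ _ mu
  (fun m => annulus (engulfing (ccube 0 (scale R m))) 0) mt _ _ [set x | c < x]%E.
- by apply: bigcup_measurable => m _; exact: mt.
- move=> m n mn; apply/subsetPset; apply: annulusS => A mA x x0.
  by apply: mA => i; apply: le_trans (x0 i) _; exact: scale_le.
- by apply: open_nbhs_nbhs; split=> //; exact: open_ereal_gt_ereal.
- by move=> m _ /(_ m (leqnn m)) mc; exists m.
Qed.

End density.

(** * Void probabilities *)

Section void_probability.
Context (R : realType) (disp disp' : measure_display).
Context (T : measurableType disp) (Omega : measurableType disp').
Context (P : probability Omega R) (pt : nat -> Omega -> option T).
Context (nu : set T -> \bar R).
Context (pt_poisson : is_poisson P pt nu).
Definition void (D : set T) : set Omega :=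
  [set w | forall n G, pt n w = Some G -> ~ D G].

Lemma voidE D : void D = [set w | point_count R pt D w = 0%:R%:E].
Proof.
have ge0 w n : (0 <= (\1_(point_in pt n D) w : R)%:E)%E by rewrite lee_fin indicE.
apply/seteqP; split=> w /=.
  move=> wD; apply: eseries0 => n _ _; rewrite indicE memNset// => -[G wG DG].
  exact: wD wG DG.
move=> wD n G wG DG.
(* The partial sum must include the index [n], where a point in [D] contributes 1. *)
have : (\sum_(0 <= k < n.+1) (\1_(point_in pt k D) w)%:E <= 0%:R%:E :> \bar R)%E.
  by rewrite -wD; apply: nneseries_lim_ge => k _ _; exact: ge0.
rewrite big_nat_recr//= [in X in (_ + X)%E]indicE mem_set; last by exists G.
move=> le0; have : (1%:E <= 0%:R%:E :> \bar R)%E.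
  by apply: le_trans le0; rewrite leeDr// sume_ge0.
by rewrite lee_fin ler10.
Qed.

Lemma measurable_void D : measurable D -> measurable (void D).
Proof.
move=> mD; have -> : void D = \bigcap_n ~` point_in pt n D.
  apply/seteqP; split=> w wD n; first by move=> _ [G /wD].
  by move=> G wG DG; apply: (wD n) => //; exists G.
apply: bigcapT_measurable => n; apply: measurableC.
exact: poisson_measurable pt_poisson _ _ mD.
Qed.

Lemma void_prob D (r : R) : measurable D -> nu D = r%:E ->
  P (void D) = (expR (- r))%:E.
Proof.
move=> mD Dr; rewrite voidE (poisson_fin pt_poisson 0 mD Dr).
by rewrite expr0 fact0 divr1 mul1r.
Qed.

Lemma void_prob1 D : measurable D -> nu D = 0%E -> P (~` void D) = 0%E.
Proof.
move=> mD D0; rewrite probability_setC; last exact: measurable_void.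
by rewrite (void_prob mD D0) oppr0 expR0 subee.
Qed.

Lemma voidU (D D' : set T) : void (D `|` D') = void D `&` void D'.
Proof.
apply/seteqP; split=> w.
  by move=> wD; split=> n G wG DG; apply: (wD n G wG); [left|right].
by move=> [wD wD'] n G wG [|]; [exact: wD wG|exact: wD' wG].
Qed.

End void_probability.

(** * Union bound and second moment bound for finitely many events *)

Section finite_unions.
Context (R : realType) (disp : measure_display) (Omega : measurableType disp).
Context (P : probability Omega R) (I : finType) (E : I -> set Omega).
Context (mE : forall i, measurable (E i)).
Lemma bigcup_finType : \bigcup_i E i = \big[setU/set0]_i E i.
Proof.
rewrite -bigcup_seq; apply: eq_bigcupl; split=> i _ //=.
by rewrite mem_index_enum.
Qed.

Lemma measurable_bigcup_finType : measurable (\bigcup_i E i).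
Proof. by rewrite bigcup_finType; apply: bigsetU_measurable => i _; exact: mE. Qed.

Lemma prob_bigcup_le : (P (\bigcup_i E i) <= \sum_i P (E i))%E.
Proof.
rewrite bigcup_finType.
elim: index_enum => [|i s IH]; first by rewrite !big_nil measure0.
rewrite !big_cons; apply: le_trans (measureU2 _ _ _) _; first exact: mE.
  by apply: bigsetU_measurable => j _; exact: mE.
exact: leeD.
Qed.

(* Integrate [2 t Z <= t^2 1_{Z > 0} + Z^2] where [Z] counts the events that
   occur, and take [t = c s]. *)
Lemma second_moment (c s : R) : 0 < c -> 0 < s -> (\sum_i P (E i) = s%:E)%E ->
  (\sum_i \sum_j P (E i `&` E j) <= (c * s ^+ 2)%:E)%E ->
  (c^-1%:E <= P (\bigcup_i E i))%E.
Proof.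
move=> c0 s0 Es EEs; set U := \bigcup_i E i; set t := c * s.
have t0 : 0 < t by rewrite mulr_gt0.
have mU : measurable U by exact: measurable_bigcup_finType.
have mind A : measurable A -> measurable_fun [set: Omega] (fun w => (\1_A w)%:E : \bar R).
  by move=> mA; apply/measurable_EFinP; exact: measurable_indic.
have ind0 (A : set Omega) w : (0 <= (\1_A w)%:E :> \bar R)%E by rewrite lee_fin indicE.
have indP (A : set Omega) : measurable A -> (\int[P]_w (\1_A w)%:E = P A)%E.
  by move=> mA; rewrite integral_indic// setIT.
have le_int : (\int[P]_w ((2 * t)%:E * \sum_i (\1_(E i) w)%:E) <=
    \int[P]_w ((t ^+ 2)%:E * (\1_U w)%:E + \sum_i \sum_j (\1_(E i `&` E j) w)%:E))%E.
  apply: ge0_le_integral => //.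
  - move=> w _; apply: mule_ge0; last exact: sume_ge0.
    by rewrite lee_fin mulr_ge0// ltW.
  - apply: emeasurable_funM; first exact: measurable_cst.
    by apply: emeasurable_sum => i; exact: mind.
  - apply: emeasurable_funD.
      apply: emeasurable_funM; [exact: measurable_cst|exact: mind].
    apply: emeasurable_sum => i; apply: emeasurable_sum => j; apply: mind.
    exact: measurableI.
  move=> w _; set Z : R := \sum_i \1_(E i) w.
  have -> : (\sum_i (\1_(E i) w)%:E = Z%:E)%E by rewrite sumEFin.
  have -> : (\sum_i \sum_j (\1_(E i `&` E j) w)%:E = (Z ^+ 2)%:E)%E.
    rewrite expr2 mulr_suml -sumEFin; apply: eq_bigr => i _.
    rewrite mulr_sumr -sumEFin; apply: eq_bigr => j _.
    by rewrite indicI.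
  rewrite -!EFinM -EFinD lee_fin.
  have [Uw|Uw] := pselect (U w).
    by rewrite indicE mem_set// mulr1; have := sqr_ge0 (t - Z); rewrite sqrrB; lra.
  have -> : Z = 0.
    apply: big1 => i _; rewrite indicE memNset// => Ew; apply: Uw; by exists i.
  by rewrite indicE memNset// !mulr0 expr0n addr0.
have mS : measurable_fun [set: Omega] (fun w => \sum_i (\1_(E i) w)%:E : \bar R)%E.
  by apply: emeasurable_sum => i; exact: mind.
have mSS i : measurable_fun [set: Omega]
    (fun w => \sum_j (\1_(E i `&` E j) w)%:E : \bar R)%E.
  by apply: emeasurable_sum => j; apply: mind; exact: measurableI.
have S0 w : (0 <= \sum_i (\1_(E i) w)%:E :> \bar R)%E by exact: sume_ge0.
have SS0 i w : (0 <= \sum_j (\1_(E i `&` E j) w)%:E :> \bar R)%E by exact: sume_ge0.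
have t20 : 0 < 2 * t by rewrite mulr_gt0.
have lhsE : (\int[P]_w ((2 * t)%:E * \sum_i (\1_(E i) w)%:E) = (2 * t * s)%:E)%E.
  rewrite ge0_integralZl// ?lee_fin ?(ltW t20)//.
  rewrite ge0_integral_sum//; last by move=> i; exact: mind.
  by rewrite (eq_bigr (fun i => P (E i))) ?Es// => i _; exact: indP.
have rhsE : (\int[P]_w ((t ^+ 2)%:E * (\1_U w)%:E +
    \sum_i \sum_j (\1_(E i `&` E j) w)%:E) =
    (t ^+ 2)%:E * P U + \sum_i \sum_j P (E i `&` E j))%E.
  rewrite ge0_integralD//; last 4 first.
  - by move=> w _; apply: mule_ge0 => //; rewrite lee_fin sqr_ge0.
  - by apply: emeasurable_funM; [exact: measurable_cst|exact: mind].
  - by move=> w _; exact: sume_ge0.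
  - by apply: emeasurable_sum => i; exact: mSS.
  rewrite ge0_integralZl// ?lee_fin ?sqr_ge0//; last exact: mind.
  rewrite indP// ge0_integral_sum//; congr (_ + _)%E.
  apply: eq_bigr => i _; rewrite ge0_integral_sum//; last first.
    by move=> j; apply: mind; exact: measurableI.
  by apply: eq_bigr => j _; apply: indP; exact: measurableI.
move: le_int; rewrite lhsE rhsE => le_int.
have := le_trans le_int (leeD2l _ EEs).
have /fineK <- : P U \is a fin_num by exact: fin_num_measure.
(* With [t = c s] this reads [2 c s^2 <= c^2 s^2 P(U) + c s^2], to be divided by [c s^2]. *)
rewrite -EFinM -EFinD !lee_fin => le2.
have cs0 : 0 < c * s ^+ 2 by rewrite mulr_gt0// exprn_gt0.
rewrite -[c^-1]mul1r ler_pdivrMr// -(ler_pM2l cs0).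
by move: le2; rewrite /t; lra.
Qed.

End finite_unions.

(** * Supercritical intensities: first moment *)

Section covering.
Context (R : realType) (d : nat) (F : set (set (small_set R d))).
Context (F_suitable : suitable F).
Local Notation T := (g_sigma_algebraType F).
Context (mu : {measure set T -> \bar R}).
Context (mu_translation : translation_invariant mu).
Context (mu_scale : semi_scale_invariant mu).
Context (mu_hitting : forall (A : set 'rV[R]_d) (delta : R),
  bounded_set A -> 0 < delta -> (mu (hitting A delta) < +oo)%E).
Context (mu_boundary : mu (@fat_boundary R d) = 0%E).
(* [phi] is either the identity or the closure. *)
Context (phi : small_set R d -> small_set R d).
Context (phi_measurable : forall D : set T,
  measurable D -> measurable (phi @^-1` D : set T)).
Context (phi_diam : forall G, diam (phi G) = diam G).
Context (sub_phi : forall G, small_val G `<=` phi G).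
Context (phi_sub : forall G, small_val (phi G) `<=` closure G).
(** An open cube meeting the closure of [G] meets [G] itself, so the hitting condition on [mu] also
    controls the image under [phi]. *)
Lemma phi_lty (D : set T) x k : measurable D -> D `<=` hitting (cube x 1) (scale R k) ->
  (mu (phi @^-1` D) < +oo)%E.
Proof.
move=> mD Dx; have s0 := scale_gt0 R k; have bx := @bounded_cube R d x 1.
apply: le_lt_trans (mu_hitting bx s0); apply: le_measure; rewrite ?inE.
- exact: phi_measurable.
- exact: measurable_hitting.
move=> G /Dx[[y [/phi_sub Gy xy]]]; rewrite phi_diam => GE; split=> //.
by apply: closure_meets; [exact: open_cube|exists y].
Qed.

(** The cube to be engulfed shrinks in proportion to the shell, which makes all [k] shells equally
    heavy. As [j < k], each of these sets contains the cube of radius [2^-(m+k)] about [x]. *)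
Definition covers m k x : set T :=
  \bigcup_(j in `I_k) annulus (engulfing (ccube x (scale R m * scale R j))) j.

Lemma measurable_covers m k x : measurable (covers m k x).
Proof.
apply: bigcup_measurable => j _; apply: measurable_engulfing => //.
  exact: compact_ccube.
by apply: ccube_neq0; rewrite -scaleD; exact: scale_gt0.
Qed.

Lemma covers_hitting m k x : covers m k x `<=` hitting (cube x 1) (scale R k).
Proof.
move=> G [j /= jk [xG /andP[GE _]]]; split.
  exists x; split; last exact: cube_center.
  apply: xG; apply: cube_sub_ccube; apply: cube_center.
  by rewrite -scaleD; exact: scale_gt0.
by apply: le_trans GE; rewrite lee_fin; exact: scale_le.
Qed.

Lemma mu_covers m k x (b : R) :
  mu (annulus (engulfing (ccube 0 (scale R m))) 0) = b%:E ->
  mu (covers m k x) = (k%:R * b)%:E.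
Proof.
move=> mb; rewrite /covers bigcup_mkord measure_bigsetU_ord.
- rewrite (eq_bigr (fun=> b%:E)); last first.
    move=> j _; rewrite -mb.
    exact: (mu_engulfing_cube F_suitable mu_translation mu_scale mu_hitting x j
      (scale_gt0 R m)).
  by rewrite sumEFin sumr_const card_ord mulr_natl.
- move=> j; apply: measurable_engulfing => //; first exact: compact_ccube.
  by apply: ccube_neq0; rewrite -scaleD; exact: scale_gt0.
- by move=> i j _ _ [G [iG jG]]; apply/val_inj; exact: annulus_inj iG jG.
Qed.

Context (lambda : {posnum R}).
Context (Psi : poisson_process (T := T)
  (fun D => (lambda%:num)%:E * mu (phi @^-1` D))%E).
Local Notation P := (pp_prob Psi).
Local Notation voidp D := (void (pp_point (p := Psi)) D).

Lemma measurable_voidp (D : set T) : measurable D -> measurable (voidp D).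
Proof. move=> mD. exact: (measurable_void (pp_is_poisson Psi) mD). Qed.

(** If [G] engulfs a cube then so does [phi G], but not conversely. The intensity of the process on
    [covers m k x] is thus at least [lambda k b], and the void probability is only bounded above. *)
Lemma void_covers_le m k x (b : R) :
  mu (annulus (engulfing (ccube 0 (scale R m))) 0) = b%:E ->
  (P (voidp (covers m k x)) <= (expR (- (lambda%:num * b)) ^+ k)%:E)%E.
Proof.
move=> mb; have mc := measurable_covers m k x.
have coo := phi_lty mc (@covers_hitting m k x).
have cE : mu (phi @^-1` covers m k x) = (fine (mu (phi @^-1` covers m k x)))%:E.
  by rewrite fineK// ge0_fin_numE.
rewrite (void_prob (pp_is_poisson Psi) mc
  (r := lambda%:num * fine (mu (phi @^-1` covers m k x)))).
  rewrite lee_fin -expRM_natl ler_expR mulrN lerN2 mulrCA ler_pM2l// -lee_fin.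
  rewrite -cE -(mu_covers k x mb); apply: le_measure; rewrite ?inE//.
    exact: phi_measurable.
  move=> G [j jk [GK GE]]; exists j => //; split; last by rewrite phi_diam.
  by move=> y /GK; exact: sub_phi.
by rewrite EFinM -cE.
Qed.

(** The grid has step [2^-(m+k)] and spans the cube of radius [M]; the successor accounts for both
    endpoints of each side. *)
Definition uncovered m M k : set (pp_space Psi) :=
  \bigcup_(f : {ffun 'I_d -> 'I_(2 * M * 2 ^ (m + k)).+1})
    voidp (covers m k (grid (- M%:R) (scale R (m + k)) f)).

Lemma grid_dense m M k x : ccube 0 M%:R x ->
  exists f : {ffun 'I_d -> 'I_(2 * M * 2 ^ (m + k)).+1},
    ccube (grid (- M%:R) (scale R (m + k)) f) (scale R (m + k)) x.
Proof.
move=> xM; have s0 := scale_gt0 R (m + k); set e := scale R (m + k) in s0 *.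
pose t i := Num.trunc ((x 0 i + M%:R) / e).
have xi i : 0 <= x 0 i + M%:R <= 2 * M%:R.
  by have := xM i; rewrite mxE sub0r normrN ler_norml; lra.
have tP i : (t i)%:R <= (x 0 i + M%:R) / e < (t i).+1%:R.
  by apply: truncn_itv; rewrite divr_ge0 ?(ltW s0)//; case/andP: (xi i).
have tlt i : (t i < (2 * M * 2 ^ (m + k)).+1)%N.
  rewrite ltnS -(ler_nat R) !natrM natrX; case/andP: (tP i) => /le_trans + _; apply.
  rewrite ler_pdivrMr// -!mulrA /e /scale -exprMn divff// expr1n mulr1.
  by case/andP: (xi i).
exists [ffun i => Ordinal (tlt i)] => i; rewrite mxE ffunE/=.
have := tP i; rewrite ler_pdivlMr// ltr_pdivrMr// -natr1 mulrDl mul1r => ti.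
by rewrite ler_norml; lra.
Qed.

(** A set in [covers] at a grid point within [2^-(m+k)] of [x] would contain [x]. *)
Lemma vacant_uncovered m M k w x : vacant w x -> ccube 0 M%:R x ->
  uncovered m M k w.
Proof.
move=> xw xM; have [f fx] := grid_dense m k xM; exists f => // n G wG [j jk [GK _]].
apply: xw; exists n, G; split=> //; apply: GK => i; apply: le_trans (fx i) _.
by rewrite -scaleD scale_le// leq_add2l ltnW.
Qed.

(** Union bound over the grid. The number of values per coordinate is relaxed by
    [2 M 2^(m+k) + 1 <= (2 M + 1) 2^(m+k)] to isolate a [k]-th power. *)
Lemma uncovered_le m M k (b : R) :
  mu (annulus (engulfing (ccube 0 (scale R m))) 0) = b%:E ->
  (P (uncovered m M k) <= (((2 * M).+1 * 2 ^ m)%:R ^+ d *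
    (2 ^+ d * expR (- (lambda%:num * b))) ^+ k)%:E)%E.
Proof.
move=> mb; apply: le_trans (prob_bigcup_le _ _) _.
  by move=> f; apply: measurable_voidp; exact: measurable_covers.
apply: le_trans (lee_sum _ (fun f _ => void_covers_le _ _ mb)) _.
rewrite sumEFin lee_fin sumr_const card_ffun !card_ord -[leLHS]mulr_natl.
rewrite [X in _ <= _ * X]exprMn mulrA ler_wpM2r//.
rewrite natrX -exprM [(d * k)%N]mulnC exprM -exprMn lerXn2r ?nnegrE ?mulr_ge0 ?exprn_ge0//.
rewrite -natrX -natrM ler_nat.
have -> : ((2 * M).+1 * 2 ^ m * 2 ^ k = (2 * M).+1 * 2 ^ (m + k))%N.
  by rewrite expnD mulnA.
by rewrite mulSn -add1n leq_add2r expn_gt0.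
Qed.

(** The strict inequality leaves room to replace the cover rate by the intensity [b] of sets
    engulfing a small cube. Then [2^d exp(- lambda b) < 1] and the union bound decays geometrically
    in [k]. *)
Lemma ae_covered : ((d%:R * ln 2)%:E < (lambda%:num)%:E * cover_rate mu)%E ->
  {ae P, forall w, vacant (Phi := Psi) w = set0}.
Proof.
have afin := cover_rate_fin_num F_suitable mu_hitting.
have l0 : 0 < lambda%:num by [].
rewrite -(fineK afin) -EFinM lte_fin -ltr_pdivrMl// -lte_fin fineK//.
move=> /(engulfing_gt_cover_rate F_suitable mu_translation mu_scale mu_hitting mu_boundary)[m].
have : (mu (annulus (engulfing (ccube 0 (scale R m))) 0) < +oo)%E.
  apply: (mu_annulus_lty F_suitable mu_hitting (bounded_ccube 0 1)).
    move=> A cA; have [x x0] := ccube_neq0 (0 : 'rV[R]_d) (scale_gt0 R m).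
    exists x; split; first exact: cA.
    by move=> i; apply: le_trans (x0 i) _; exact: scale_le1.
  by apply: measurable_engulfing => //; [exact: compact_ccube|exact: ccube_neq0 (scale_gt0 R m)].
rewrite -ge0_fin_numE// => /fineK; set b := fine _ => /esym mb.
rewrite mb lte_fin ltr_pdivrMl// => db.
set q := 2 ^+ d * expR (- (lambda%:num * b)).
have q0 : 0 <= q by rewrite mulr_ge0 ?expR_ge0 ?exprn_ge0.
have q1 : q < 1.
  have -> : q = expR (d%:R * ln 2 - lambda%:num * b).
    by rewrite expRD expRM_natl lnK// posrE.
  by rewrite expR_lt1 subr_lt0.
have mU M k : measurable (uncovered m M k).
  apply: measurable_bigcup_finType => f; apply: measurable_voidp.
  exact: measurable_covers.
(* A vacant point in the cube of radius [M] forces [uncovered m M k] for every [k]. *)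
pose N M := \bigcap_k uncovered m M k.
have mN M : measurable (N M) by exact: bigcapT_measurable.
have PN M : P (N M) = 0%E.
  apply/eqP; rewrite eq_le measure_ge0 andbT.
  have /fineK PE : P (N M) \is a fin_num by exact: fin_num_measure.
  rewrite -PE lee_fin leNgt; apply/negP => p0.
  have qabs : `|q| < 1 by rewrite ger0_norm.
  have := @cvg_geometric R (((2 * M).+1 * 2 ^ m)%:R ^+ d) q qabs.
  move=> /cvgrPdist_lt/(_ _ p0)[k _ /(_ k (leqnn k))] /=.
  rewrite sub0r normrN => /(le_lt_trans (ler_norm _)); apply/negP; rewrite -leNgt.
  rewrite -lee_fin PE; apply: le_trans (uncovered_le M k mb).
  by apply: le_measure; rewrite ?inE//; exact: (@bigcap_inf _ _ k setT (uncovered m M)).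
have : P.-negligible (\bigcup_M N M).
  by apply: negligible_bigcup => M; exists (N M); split; [exact: mN|exact: PN|].
apply: negligibleS => w /= /eqP/set0P[x xw].
have [M xM] := in_ccube x.
by exists M => // k _; exact: (vacant_uncovered _ _ xw).
Qed.

End covering.

(** * Subcritical intensities: second moment *)

(** As [p] holds on an initial segment, the product is a single power of [b], which is one of the
    terms on the right. *)
Lemma prod_initial_le (R : realFieldType) (b : R) (p : pred nat) k : 1 <= b ->
  (forall i j, (i <= j)%N -> p j -> p i) ->
  \prod_(j < k) (if p j then b else 1) <= 1 + \sum_(j < k) (if p j then b ^+ j.+1 else 0).
Proof.
move=> b1 pinit; elim: k => [|k IH]; first by rewrite !big_ord0 addr0.
rewrite !big_ord_recr/=; case: ifPn => pk; last by rewrite mulr1 addr0.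
rewrite (eq_bigr (fun=> b)); last first.
  by move=> j _; rewrite (pinit j k)// ltnW.
rewrite prodr_const card_ord -exprSr addrA lerDr addr_ge0//.
by apply: sumr_ge0 => j _; case: ifP => // _; rewrite exprn_ge0// (le_trans ler01).
Qed.

Lemma geometric_sum_le (R : realFieldType) (z : R) k : 0 <= z < 1 ->
  \sum_(j < k) z ^+ j <= (1 - z)^-1.
Proof.
move=> /andP[z0 z1]; have z10 : 0 < 1 - z by rewrite subr_gt0.
rewrite -[leRHS]mul1r ler_pdivlMr// mulrC.
have := subrX1 z k; have := exprn_ge0 k z0; lra.
Qed.

Section vacancy.
Context (R : realType) (d : nat) (F : set (set (small_set R d))).
Context (F_suitable : suitable F).
Local Notation T := (g_sigma_algebraType F).
Context (mu : {measure set T -> \bar R}).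
Context (mu_translation : translation_invariant mu).
Context (mu_scale : semi_scale_invariant mu).
Context (mu_hitting : forall (A : set 'rV[R]_d) (delta : R),
  bounded_set A -> 0 < delta -> (mu (hitting A delta) < +oo)%E).
Context (phi : small_set R d -> small_set R d).
Context (phi_measurable : forall D : set T,
  measurable D -> measurable (phi @^-1` D : set T)).
Context (phi_diam : forall G, diam (phi G) = diam G).
Context (sub_phi : forall G, small_val G `<=` phi G).
Context (phi_sub : forall G, small_val (phi G) `<=` closure G).
Context (lambda : {posnum R}).
Context (Psi : poisson_process (T := T)
  (fun D => (lambda%:num)%:E * mu (phi @^-1` D))%E).
Local Notation P := (pp_prob Psi).
Local Notation voidp D := (void (pp_point (p := Psi)) D).

Context (m : nat) (alpha : R).
Context (mu_alpha : mu (annulus (touching (cube 0 (scale R m))) 0) = alpha%:E).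
Definition touch j x : set T := annulus (touching (cube x (scale R m * scale R j))) j.

Definition touches k x : set T := \bigcup_(j in `I_k) touch j x.

Lemma measurable_touch j x : measurable (touch j x).
Proof. by apply: measurable_touching => //; exact: bounded_cube. Qed.

Lemma measurable_touches k x : measurable (touches k x).
Proof. by apply: bigcup_measurable => j _; exact: measurable_touch. Qed.

(** An open cube meets [phi G] exactly when it meets [G], since [phi G] lies between [G] and its
    closure. Touching intensities are therefore exact for both processes. *)
Lemma phi_touch j x : phi @^-1` touch j x = touch j x.
Proof.
have s0 : 0 < scale R m * scale R j by rewrite mulr_gt0 ?scale_gt0.
apply/seteqP; split=> G [[y [Gy xy]] GE]; split; rewrite ?phi_diam// in GE *.
  by apply: closure_meets; [exact: open_cube|exists y; split=> //; exact: phi_sub].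
by exists y; split=> //; exact: sub_phi.
Qed.

Lemma phi_touches k x : phi @^-1` touches k x = touches k x.
Proof.
by rewrite /touches preimage_bigcup; apply: eq_bigcupr => j _; exact: phi_touch.
Qed.

Lemma mu_touch j x : mu (touch j x) = alpha%:E.
Proof.
rewrite -mu_alpha.
exact: (mu_touching_cube F_suitable mu_translation mu_scale mu_hitting x j
  (scale_gt0 R m)).
Qed.

Lemma mu_touches k x : mu (touches k x) = (k%:R * alpha)%:E.
Proof.
rewrite /touches bigcup_mkord measure_bigsetU_ord.
- rewrite (eq_bigr (fun=> alpha%:E)); last by move=> j _; exact: mu_touch.
  by rewrite sumEFin sumr_const card_ord mulr_natl.
- by move=> j; exact: measurable_touch.
- by move=> i j _ _ [G [iG jG]]; apply/val_inj; exact: annulus_inj iG jG.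
Qed.

Lemma void_touches k x :
  P (voidp (touches k x)) = (expR (- (lambda%:num * alpha)) ^+ k)%:E.
Proof.
rewrite (void_prob (pp_is_poisson Psi) (r := lambda%:num * (k%:R * alpha))).
- by rewrite -expRM_natl mulrN mulrCA.
- exact: measurable_touches.
- by rewrite phi_touches mu_touches.
Qed.

(** The factor 3 adds two cube radii, each at most [2^-j], and the diameter of a set of shell
    [j]. *)
Definition close j (x y : 'rV[R]_d) := [forall i, `|x 0 i - y 0 i| < 3 * scale R j].

Lemma touch_close j x y G : touch j x G -> touch j y G -> close j x y.
Proof.
move=> [[u [Gu xu]] /andP[_ GE]] [[v [Gv yv]] _]; apply/forallP => i.
have := xu i; have := yv i; have := norm_le_edist u v i.
have : Defs.edist u v < scale R j.
  by rewrite -lte_fin; apply: le_lt_trans GE; exact: diam_ub.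
have : scale R m * scale R j <= scale R j.
  by rewrite ler_piMl ?scale_le1// ltW// scale_gt0.
rewrite !ltr_norml ler_norml; lra.
Qed.

(** Shells are disjoint, so a set in both families touches both cubes in one common shell, at whose
    scale [x] and [y] are close. *)
Lemma mu_touches_touches k x y : (mu (touches k x `&` touches k y) <=
  (\sum_(j < k) (if close j x y then alpha else 0))%:E)%E.
Proof.
pose D j := if close j x y then touch j x else set0.
have mD j : measurable (D j) by rewrite /D; case: ifP => // _; exact: measurable_touch.
have sub : touches k x `&` touches k y `<=` \big[setU/set0]_(j < k) D j.
  move=> G [[i ik iG] [j jk jG]]; rewrite -bigcup_mkord; exists i => //.
  have ij := annulus_inj iG jG; rewrite -ij in jG.
  by rewrite /D (touch_close iG jG).
apply: (@le_trans _ _ (mu (\big[setU/set0]_(j < k) D j))).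
  apply: le_measure; rewrite ?inE//.
    by apply: measurableI; exact: measurable_touches.
  by apply: bigsetU_measurable => j _; exact: mD.
apply: le_trans (Boole_inequality _ _) _; first by move=> j _; exact: mD.
rewrite -sumEFin; apply: lee_sum => j _; rewrite /D.
by case: ifP => _; [rewrite -(mu_touch j x)|rewrite measure0].
Qed.

Lemma alpha_ge0 : 0 <= alpha.
Proof. by rewrite -lee_fin -mu_alpha measure_ge0. Qed.

Let b := expR (lambda%:num * alpha).

(** If the two families overlap in mass [c], their union has mass [2 k alpha - c], so the joint void
    probability is the product of the two times [exp(lambda c)]. Closeness at a scale implies
    closeness at all coarser ones, so [prod_initial_le] bounds this factor. *)
Lemma void_touches2 k x y :
  (P (voidp (touches k x) `&` voidp (touches k y)) <=
  ((expR (- (lambda%:num * alpha)) ^+ k) ^+ 2 *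
   (1 + \sum_(j < k) (if close j x y then b ^+ j.+1 else 0)))%:E)%E.
Proof.
rewrite -voidU.
have mx := measurable_touches k x; have my := measurable_touches k y.
have mxy := measurableI _ _ mx my.
have le2 := mu_touches_touches k x y.
set c := fine (mu (touches k x `&` touches k y)).
have cE : mu (touches k x `&` touches k y) = c%:E.
  rewrite fineK// ge0_fin_numE//; apply: le_lt_trans le2 _.
  exact: ltry.
rewrite cE lee_fin in le2.
rewrite (void_prob (pp_is_poisson Psi)
  (r := lambda%:num * (k%:R * alpha + k%:R * alpha - c))); last 2 first.
- exact: measurableU.
- rewrite preimage_setU !phi_touches measureUfinl//; last by rewrite mu_touches ltry.
  by rewrite cE !mu_touches.
rewrite lee_fin.
have -> : - (lambda%:num * (k%:R * alpha + k%:R * alpha - c)) =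
    k%:R * - (lambda%:num * alpha) * 2%:R + lambda%:num * c by lra.
rewrite expRD expRM_natr expRM_natl ler_pM2l ?exprn_gt0 ?expR_gt0//.
have b1 : 1 <= b by rewrite /b -expR0 ler_expR mulr_ge0// alpha_ge0.
have nearS i j : (i <= j)%N -> close j x y -> close i x y.
  move=> ij /forallP ji; apply/forallP => l; apply: lt_le_trans (ji l) _.
  by rewrite ler_pM2l// scale_le.
apply: le_trans (@prod_initial_le R b (fun j => close j x y) k b1 nearS).
rewrite (eq_bigr (fun j : 'I_k => expR (lambda%:num * if close j x y then alpha else 0))).
  by rewrite -expR_sum -mulr_sumr ler_expR ler_pM2l.
by move=> j _; case: ifP => // _; rewrite mulr0 expR0.
Qed.


(** An interval of length [6 * 2^-j] holds at most [6 * 2^(k-j) + 1] grid values, and the 1 is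
    absorbed into the 7 because [j <= k]. *)
Lemma card_near k j (f : {ffun 'I_d -> 'I_(2 ^ k)}) : (j <= k)%N ->
  #|[pred g : {ffun 'I_d -> 'I_(2 ^ k)} | close j (grid 0 (scale R k) f) (grid 0 (scale R k) g)]|%:R <=
  (7 * scale R j * 2 ^+ k) ^+ d.
Proof.
move=> jk; have sk := scale_gt0 R k; have sj := scale_gt0 R j.
pose x := grid 0 (scale R k) f.
pose ab := (x - const_mx (3 * scale R j), x + const_mx (3 * scale R j)).
have -> : #|[pred g : {ffun 'I_d -> 'I_(2 ^ k)} | close j x (grid 0 (scale R k) g)]| =
    #|[pred g : {ffun 'I_d -> 'I_(2 ^ k)} | `[< open_box ab (grid 0 (scale R k) g) >]]|.
  apply: eq_card => g; rewrite !inE /=; apply/forallP/asboolP => xg i;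
    by move: (xg i); rewrite /= ltr_distlC !mxE.
apply: le_trans (card_grid_open_box _ _ sk _) _.
  by move=> i; rewrite /= !mxE; lra.
rewrite -[X in _ <= _ ^+ X]card_ord -prodr_const; apply: ler_prod => i _.
have E : (scale R k)^-1 = 2 ^+ k by rewrite /scale exprVn invrK.
have : 1 <= scale R j * 2 ^+ k.
  by rewrite -E ler_pdivlMr// mul1r scale_le.
rewrite !mxE -E; set u := (scale R k)^-1 => u1.
apply/andP; split; first by nra.
by rewrite -[leRHS]mulrA; lra.
Qed.

Definition vacant_grid k : set (pp_space Psi) :=
  \bigcup_(f : {ffun 'I_d -> 'I_(2 ^ k)}) voidp (touches k (grid 0 (scale R k) f)).

Context (b_lt : b < 2 ^+ d).
(** At scale [j], at most [(7 * 2^(k-j))^d] grid points are close to a given one, each with weight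
    [b^(j+1)]. Relative to the [2^(kd)] grid points this is a geometric series of ratio
    [b / 2^d < 1], so the bound is uniform in [k]. *)
Definition correlation_bound := 1 + 7 ^+ d * b / (1 - b / 2 ^+ d).

Lemma correlation_bound_gt0 : 0 < correlation_bound.
Proof.
have b0 : 0 < b by exact: expR_gt0.
rewrite ltr_wpDr// divr_ge0 ?mulr_ge0 ?exprn_ge0 ?ltW// subr_gt0.
by rewrite ltr_pdivrMr ?exprn_gt0// mul1r.
Qed.

Lemma sum_near_le k (f : {ffun 'I_d -> 'I_(2 ^ k)}) :
  \sum_(g : {ffun 'I_d -> 'I_(2 ^ k)}) (1 + \sum_(j < k)
    (if close j (grid 0 (scale R k) f) (grid 0 (scale R k) g)
     then b ^+ j.+1 else 0)) <= correlation_bound * (2 ^+ k) ^+ d.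
Proof.
have b0 : 0 < b by exact: expR_gt0.
rewrite big_split/= sumr_const card_ffun !card_ord natrX natrX mulrDl mul1r.
rewrite lerD2l exchange_big/=.
have le1 (j : 'I_k) : \sum_(g : {ffun 'I_d -> 'I_(2 ^ k)})
    (if close j (grid 0 (scale R k) f) (grid 0 (scale R k) g)
     then b ^+ j.+1 else 0) <=
    (7 ^+ d * b * (2 ^+ k) ^+ d) * (b / 2 ^+ d) ^+ j.
  rewrite -big_mkcond/= sumr_const -[leLHS]mulr_natl.
  have := card_near f (ltnW (ltn_ord j)).
  rewrite -(ler_pM2r (exprn_gt0 j.+1 b0)) => /le_trans; apply.
  have E : scale R j ^+ d = (2 ^+ d)^-1 ^+ j.
    by rewrite /scale -exprM mulnC exprM [2^-1 ^+ d]exprVn.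
  rewrite !exprMn E exprS.
  by rewrite le_eqVlt; apply/orP; left; apply/eqP; ring.
apply: le_trans (ler_sum _ (fun j _ => le1 j)) _.
rewrite -mulr_sumr.
have z01 : 0 <= b / 2 ^+ d < 1.
  by rewrite divr_ge0 ?exprn_ge0 ?(ltW b0)//= ltr_pdivrMr ?exprn_gt0// mul1r.
rewrite [leRHS]mulrAC; apply: ler_wpM2l (geometric_sum_le k z01).
by rewrite !mulr_ge0 ?exprn_ge0 ?ltW.
Qed.

Lemma measurable_void_touches k x : measurable (voidp (touches k x)).
Proof. exact: (measurable_void (pp_is_poisson Psi) (measurable_touches k x)). Qed.

Lemma vacant_grid_ge k : (correlation_bound^-1%:E <= P (vacant_grid k))%E.
Proof.
pose q := expR (- (lambda%:num * alpha)) ^+ k.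
have q0 : 0 < q by rewrite exprn_gt0// expR_gt0.
have N0 : 0 < (2 ^+ k) ^+ d :> R by rewrite !exprn_gt0.
(* The last argument is the expected number of grid points whose families are void. *)
apply: (@second_moment _ _ _ P _ _ _ correlation_bound ((2 ^+ k) ^+ d * q)).
- by move=> f; exact: measurable_void_touches.
- exact: correlation_bound_gt0.
- by rewrite mulr_gt0.
- rewrite (eq_bigr (fun=> q%:E)); last by move=> f _; exact: void_touches.
  by rewrite sumEFin sumr_const card_ffun !card_ord -[q *+ _]mulr_natl natrX natrX.
apply: le_trans (lee_sum _ (fun f _ => lee_sum _ (fun g _ => void_touches2 _ _ _))) _.
under eq_bigr do rewrite sumEFin -mulr_sumr.
rewrite sumEFin lee_fin -mulr_sumr -/q.
apply: (@le_trans _ _ (q ^+ 2 * (\sum_(f : {ffun 'I_d -> 'I_(2 ^ k)})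
    correlation_bound * (2 ^+ k) ^+ d))).
  by rewrite ler_wpM2l ?sqr_ge0// ler_sum// => f _; exact: sum_near_le.
rewrite sumr_const card_ffun !card_ord -[X in _ * X <= _]mulr_natl natrX natrX.
by rewrite le_eqVlt; apply/orP; left; apply/eqP; ring.
Qed.

End vacancy.

(** * Vacant points as cluster points of vacant grid points *)

Section criticality.
Context (R : realType) (d : nat) (F : set (set (small_set R d))).
Context (d_gt0 : (0 < d)%N).
Context (F_suitable : suitable F).
Local Notation T := (g_sigma_algebraType F).
Context (mu : {measure set T -> \bar R}).
Context (mu_translation : translation_invariant mu).
Context (mu_scale : semi_scale_invariant mu).
Context (mu_open : mu (~` @open_sets R d) = 0%E).
Context (mu_hitting : forall (A : set 'rV[R]_d) (delta : R),
  bounded_set A -> 0 < delta -> (mu (hitting A delta) < +oo)%E).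
Context (phi : small_set R d -> small_set R d).
Context (phi_measurable : forall D : set T,
  measurable D -> measurable (phi @^-1` D : set T)).
Context (phi_diam : forall G, diam (phi G) = diam G).
Context (sub_phi : forall G, small_val G `<=` phi G).
Context (phi_sub : forall G, small_val (phi G) `<=` closure G).
Context (lambda : {posnum R}).
Context (Psi : poisson_process (T := T)
  (fun D => (lambda%:num)%:E * mu (phi @^-1` D))%E).
Local Notation P := (pp_prob Psi).
Local Notation voidp D := (void (pp_point (p := Psi)) D).

(* These are the singletons: the empty set is open. *)
Definition pointlike : set T := (~` @open_sets R d) `\`
  \bigcup_M \bigcup_j hitting (ccube 0 M%:R) (scale R j).

Lemma measurable_not_open : measurable (~` @open_sets R d : set T).
Proof.
by apply: measurableC; rewrite (measurableF F_suitable); exact: suitable_open.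
Qed.

Lemma measurable_pointlike : measurable pointlike.
Proof.
apply: measurableD; first exact: measurable_not_open.
apply: bigcup_measurable => M _; apply: bigcup_measurable => j _.
by apply: measurable_hitting => //; [exact: bounded_ccube|exact: scale_gt0].
Qed.

Lemma hitting_exists (G : small_set R d) x : small_val G x -> (0 < diam G)%E ->
  (\bigcup_M \bigcup_j hitting (ccube 0 M%:R) (scale R j)) G.
Proof.
move=> Gx /annulus_exists[j /andP[GE _]]; have [M xM] := in_ccube x.
by exists M => //; exists j.+1 => //; split=> //; exists x.
Qed.

(** A nonempty set of diameter 0 is neither open, as [d > 0], nor in any of the hitting families. *)
Lemma pointlike_diam (G : small_set R d) x : ~ pointlike G -> small_val G x -> (0 < diam G)%E.
Proof.
move=> nG Gx; rewrite ltNge; apply/negP => G0; apply: nG; split.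
  by move=> oG; move: G0; rewrite leNgt diam_gt0//; exists x.
move=> [M _ [j _ [_ jG]]]; have := le_trans jG G0.
by rewrite lee_fin leNgt scale_gt0.
Qed.

(** [phi G] need not be open when [G] is, but if nonempty it has the diameter of a nonempty open
    set, which is positive. So [phi G] can be pointlike only when [G] is not open. *)
Lemma mu_pointlike : mu (phi @^-1` pointlike) = 0%E.
Proof.
apply: subset_measure0 mu_open.
- exact: phi_measurable measurable_pointlike.
- exact: measurable_not_open.
move=> G [nopen nhit] oG; apply: nopen.
have [G0|/set0P[y Gy]] := eqVneq (small_val (phi G)) set0.
  by rewrite /open_sets/= G0; exact: open0.
exfalso; apply: nhit; apply: (hitting_exists Gy); rewrite phi_diam.
apply: diam_gt0 => //; have [z [Gz _]] := phi_sub Gy (nbhs_cube y ltr01).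
by exists z.
Qed.

(** The strict inequality leaves room for the intensity of sets touching a small cube, which gives
    [b < 2^d] in the second moment bound. Compactness of the unit cube then produces a vacant
    point. *)
Lemma not_ae_covered : ((lambda%:num)%:E * cover_rate mu < (d%:R * ln 2)%:E)%E ->
  ~ {ae P, forall w, vacant (Phi := Psi) w = set0}.
Proof.
have afin := cover_rate_fin_num F_suitable mu_hitting.
have l0 : 0 < lambda%:num by [].
rewrite -(fineK afin) -EFinM lte_fin -ltr_pdivlMl// -lte_fin fineK//.
move=> /(touching_lt_cover_rate F_suitable mu_hitting)[m].
set c := lambda%:num^-1 * (d%:R * ln 2) => mc.
have : mu (annulus (touching (cube 0 (scale R m))) 0) \is a fin_num.
  by rewrite ge0_fin_numE// (lt_trans mc) ?ltry.
move=> /fineK; set al := fine _ => /esym mu_al.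
rewrite mu_al lte_fin /c ltr_pdivlMl// in mc.
have b_lt : expR (lambda%:num * al) < 2 ^+ d.
  have -> : 2 ^+ d = expR (d%:R * ln 2) :> R by rewrite expRM_natl lnK// posrE.
  by rewrite ltr_expR.
pose U k : set (pp_space Psi) := vacant_grid m k.
have mU k : measurable (U k).
  by apply: measurable_bigcup_finType => f; exact: measurable_void_touches.
pose V n := \bigcup_(k in [set k | (n <= k)%N]) U k.
have mV n : measurable (V n) by exact: bigcup_measurable.
have mVV : measurable (\bigcap_n V n) by exact: bigcapT_measurable.
have PU k : ((correlation_bound d lambda al)^-1%:E <= P (U k))%E.
  exact: (vacant_grid_ge F_suitable mu_translation mu_scale mu_hitting).
(* The lower bound on [P (U k)] is uniform in [k], so it passes to the limsup of these events. *)
have PV : (0 < P (\bigcap_n V n))%E.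
  apply: (@lt_le_trans _ _ (correlation_bound d lambda al)^-1%:E).
    by rewrite lte_fin invr_gt0; exact: correlation_bound_gt0.
  have cvgV : (P \o V) @ \oo --> P (\bigcap_n V n).
    apply: nonincreasing_cvg_mu => //.
      exact: le_lt_trans (probability_le1 P (mV 0%N)) (ltry _).
    move=> i j ij; apply/subsetPset => w [k /= jk wk]; exists k => //=.
    exact: leq_trans ij jk.
  rewrite -(cvg_lim _ cvgV)//; apply: lime_ge.
    by apply/cvg_ex; eexists; exact: cvgV.
  apply: nearW => n; apply: le_trans (PU n) _; apply: le_measure; rewrite ?inE//.
  by move=> w wn; exists n => /=.
move=> [N [mN PN subN]].
(* Singletons lie in no shell, so they are excluded separately, up to a null event. *)
have mD0 := measurable_pointlike.
have PD0 : P (~` voidp pointlike) = 0%E.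
  by apply: (void_prob1 (pp_is_poisson Psi)) => //; rewrite mu_pointlike mule0.
have PND : P (N `|` ~` voidp pointlike) = 0%E.
  apply/eqP; rewrite eq_le measure_ge0 andbT -(adde0 0%E) -[X in (_ <= X + _)%E]PN -PD0.
  apply: measureU2 => //; apply: measurableC.
  exact: (measurable_void (pp_is_poisson Psi) mD0).
suff sub : \bigcap_n V n `<=` N `|` ~` voidp pointlike.
  move: PV; apply/negP; rewrite -leNgt -PND; apply: le_measure; rewrite ?inE//.
  apply: measurableU => //; apply: measurableC.
  exact: (measurable_void (pp_is_poisson Psi) mD0).
move=> w Vw; have [wD|] := pselect (voidp pointlike w); last by right.
left; apply: subN => /= w0.
have /choice[x_ xP] : forall n, exists x, ccube 0 1 x /\
    exists2 k, (n <= k)%N & voidp (touches m k x : set T) w.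
  move=> n; have [k /= nk [f _ wf]] := Vw n I.
  exists (grid 0 (scale R k) f); split; first exact: grid_in_ccube.
  by exists k.
have [x [_ clx]] : exists x, (ccube 0 1 `&` cluster (x_ @ \oo)) x.
  by apply: compact_ccube; exists 0%N => // n _; exact: (xP n).1.
suff : vacant w x by rewrite w0.
move=> [n [G [wG Gx]]].
have Gd : (0 < diam G)%E by apply: pointlike_diam Gx; exact: wD wG.
have [j GE] := annulus_exists Gd.
have s0 : 0 < scale R m * scale R j by rewrite -scaleD scale_gt0.
(* Some [x_ i] with [i > j] is so near to [x] that [G] touches the cube of shell [j] about [x_ i].
   The void event at [x_ i] covers [k >= i > j] shells and forbids this. *)
have [_ [[i /= ji <-] xi]] := clx [set x_ i | i in [set i | (j < i)%N]] _
  (ex_intro2 _ _ j.+1 I (fun i ji => ex_intro2 _ _ i ji erefl)) (nbhs_cube x s0).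
have [k ik /(_ n G wG)] := (xP i).2; apply; exists j; first exact: leq_trans ji ik.
split=> //; exists x; split=> // l; rewrite distrC; exact: xi.
Qed.

End criticality.

(** Elements of [B] are at or above the threshold, and anything strictly larger lies in [A]. Nothing
    is assumed at the threshold itself, hence the [e] in the proof. *)
Lemma le_ereal_inf_threshold (R : realType) (A B : set {posnum R}) (a t : R) :
  0 < t -> (forall l : {posnum R}, t < l%:num * a -> A l) ->
  (forall l : {posnum R}, l%:num * a < t -> ~ B l) ->
  (ereal_inf [set (l%:num)%:E | l in A] <= ereal_inf [set (l%:num)%:E | l in B])%E.
Proof.
move=> t0 supA infB; apply: le_ereal_inf_tmp => _ [l Bl <-].
have tl : t <= l%:num * a by rewrite leNgt; apply/negP => /infB.
(* Positivity of [a] is extracted from an element of [B]; if there is none, the right-hand infimum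
   is [+oo]. *)
have a0 : 0 < a by rewrite -(pmulr_rgt0 _ (gt0 l)); exact: lt_le_trans tl.
apply/lee_addgt0Pr => e e0; apply: ereal_inf_lbound.
have le0 : 0 < l%:num + e by exact: addr_gt0.
exists (PosNum le0) => //; apply: supA => /=.
by apply: le_lt_trans tl _; rewrite mulrDl ltrDl mulr_gt0.
Qed.


Theorem corollary1p4 (R : realType) (d : nat) (d_gt0 : (0 < d)%N)
    (F : set (set (small_set R d))) (F_suitable : suitable F)
    (mu : {measure set (g_sigma_algebraType F) -> \bar R})
    (mu_infinite : mu setT = +oo%E)
    (mu_translation : translation_invariant mu)
    (mu_scale : semi_scale_invariant mu)
    (mu_open : mu (~` @open_sets R d) = 0%E)
    (mu_hitting : forall (A : set 'rV[R]_d) (delta : R),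
      bounded_set A -> 0 < delta -> (mu (hitting A delta) < +oo)%E)
    (mu_boundary : mu (@fat_boundary R d) = 0%E)
    (mu_volume : (0 < mu (@positive_volume R d))%E)
    (Phi : poisson_family mu)
    (Phi_closed : poisson_family (closure_image mu)) :
  lambda_e Phi = lambda_e Phi_closed.

Proof.
have afin := cover_rate_fin_num F_suitable mu_hitting.
have aE (l : {posnum R}) : ((l%:num)%:E * cover_rate mu =
    (l%:num * fine (cover_rate mu))%:E)%E by rewrite EFinM fineK.
have t0 : 0 < d%:R * ln 2 :> R by rewrite mulr_gt0 ?ltr0n// ln_gt0// ltr1n.
have closure_meas (D : set (g_sigma_algebraType F)) : measurable D ->
    measurable (@small_closure R d @^-1` D : set (g_sigma_algebraType F)).
  by rewrite !(measurableF F_suitable); exact: suitable_closure.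
(* The general results are used with [phi] the identity for [mu] and with [phi] the closure for its
   image; the threshold involves only [cover_rate mu] in both cases. *)
have open_sup l : d%:R * ln 2 < l%:num * fine (cover_rate mu) ->
    {ae pp_prob (Phi l), forall w, vacant (Phi := Phi l) w = set0}.
  rewrite -lte_fin -aE; apply: (@ae_covered R d F F_suitable mu mu_translation
    mu_scale mu_hitting mu_boundary id) => // G.
    by [].
  exact: subset_closure.
have closed_sup l : d%:R * ln 2 < l%:num * fine (cover_rate mu) ->
    {ae pp_prob (Phi_closed l), forall w, vacant (Phi := Phi_closed l) w = set0}.
  rewrite -lte_fin -aE; apply: (@ae_covered R d F F_suitable mu mu_translation
    mu_scale mu_hitting mu_boundary (@small_closure R d)) => // G.
  - exact: diam_closureE.
  - exact: subset_closure.
  - by [].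
have open_inf l : l%:num * fine (cover_rate mu) < d%:R * ln 2 ->
    ~ {ae pp_prob (Phi l), forall w, vacant (Phi := Phi l) w = set0}.
  rewrite -lte_fin -aE; apply: (@not_ae_covered R d F d_gt0 F_suitable mu
    mu_translation mu_scale mu_open mu_hitting id) => // G.
    by [].
  exact: subset_closure.
have closed_inf l : l%:num * fine (cover_rate mu) < d%:R * ln 2 ->
    ~ {ae pp_prob (Phi_closed l), forall w, vacant (Phi := Phi_closed l) w = set0}.
  rewrite -lte_fin -aE; apply: (@not_ae_covered R d F d_gt0 F_suitable mu
    mu_translation mu_scale mu_open mu_hitting (@small_closure R d)) => // G.
  - exact: diam_closureE.
  - exact: subset_closure.
  - by [].
apply/le_anti/andP; split; apply: le_ereal_inf_threshold t0 _ _; eassumption.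
Qed.
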